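(* Let $T>0$, $\mu,a\in\mathbb{R}$, let $W=(W_t)_{0\le t\le T}$ be a standard Wiener process, and let $(Y_t)_{0\le t\le T}$ satisfy $$dY_t=\mu\,dt-aY_t\,dt+dW_t$$ with deterministic initial value $Y_0\in\mathbb{R}$. Then, almost surely, the maximum likelihood estimators of $\mu$ and $a$ based on the path $(Y_t)_{0\le t\le T}$ are $$\hat\mu=\frac{\frac12\left(Y_T^2-Y_0^2-T\right)\int_0^TY_t\,dt-(Y_T-Y_0)\int_0^TY_t^2\,dt}{\left(\int_0^TY_t\,dt\right)^2-T\int_0^TY_t^2\,dt},$$ $$\hat a=\frac{\frac12T\left(Y_T^2-Y_0^2-T\right)-(Y_T-Y_0)\int_0^TY_t\,dt}{\left(\int_0^TY_t\,dt\right)^2-T\int_0^TY_t^2\,dt}.$$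
   Context: Likelihood: for $(m,b)\in\mathbb{R}^2$, let $\mu_Y^{(m,b)}$ be the law on path space of the solution of $dY_t=m\,dt-bY_t\,dt+dW_t$ started at $Y_0$, and let $\mu_W$ be the law of $(Y_0+W_t)_{0\le t\le T}$. The likelihood of $(m,b)$ given the observed path $Y$ is the Radon–Nikodym derivative $\frac{d\mu_Y^{(m,b)}}{d\mu_W}(Y)$, which by a known result (Liptser–Shiryaev) equals almost surely $$\exp\left(\int_0^T(m-bY_s)\,dY_s-\frac12\int_0^T(m-bY_s)^2\,ds\right),$$ where $\int_0^T(m-bY_s)\,dY_s=m(Y_T-Y_0)-b\int_0^TY_s\,dY_s$ with $\int_0^T Y_s\,dY_s$ an Itô integral. The maximum likelihood estimator $(\hat\mu,\hat a)$ is the maximizer of this expression over $(m,b)\in\mathbb{R}^2$. *)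

(* Defs.v *)
From HB Require Import structures.
From mathcomp Require Import all_boot all_order all_algebra.
From mathcomp Require Import all_classical all_reals all_analysis.

Set Implicit Arguments.
Unset Strict Implicit.
Unset Printing Implicit Defensive.

Import Order.TTheory GRing.Theory Num.Theory.
Import numFieldNormedType.Exports.

Local Open Scope classical_set_scope.
Local Open Scope ring_scope.

(* A process is a map [X : R -> Omega -> R], time first; only its values at the
   times of [0, T] are ever used. *)

Section processes.
Context (R : realType) (d : measure_display) (Omega : measurableType d).
Variable P : probability Omega R.
Implicit Types (F : R -> set (set Omega)) (X W H : R -> Omega -> R).

Definition measurable_wrt (G : set (set Omega)) (X : Omega -> R) : Prop :=
  forall B : set R, measurable B -> G (X @^-1` B).

Definition filtration F (T : R) : Prop :=
  (forall t : R, 0 <= t <= T ->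
     sigma_algebra [set: Omega] (F t) /\ F t `<=` measurable) /\
  (forall s t : R, 0 <= s -> s <= t -> t <= T -> F s `<=` F t).

Definition adapted F (T : R) X : Prop :=
  forall t : R, 0 <= t <= T -> measurable_wrt (F t) (X t).

Definition continuous_paths (T : R) X : Prop :=
  forall w, {within `[0, T], continuous (fun t => X t w)}.

(* The second parameter of [normal_prob] is the standard deviation. *)
Definition wiener_process F (T : R) W : Prop :=
  [/\ adapted F T W,
      continuous_paths T W,
      {ae P, forall w, W 0 w = 0},
      (forall s t : R, 0 <= s -> s < t -> t <= T ->
         forall B : set R, measurable B ->
           P ((W t \- W s) @^-1` B) = normal_prob 0 (Num.sqrt (t - s)) B) &
      (forall s t : R, 0 <= s -> s < t -> t <= T ->
         forall (A : set Omega) (B : set R), F s A -> measurable B ->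
           P (A `&` (W t \- W s) @^-1` B) =
             (P A * P ((W t \- W s)%R @^-1` B))%E)].

(* X_t = x0 + \int_0^t beta_s ds + W_t, i.e. dX_t = beta_t dt + dW_t. The
   coefficient of dW is constant, so no stochastic integral occurs. *)
Definition ito_process (T : R) W (beta : R -> Omega -> R) (x0 : R) X : Prop :=
  {ae P, forall w, forall t : R, 0 <= t <= T ->
     X t w = x0 +
       (\int[@lebesgue_measure R]_(s in `[0%R, t]) beta s w)%R + W t w}.

Definition ou_drift (m b : R) X : R -> Omega -> R := fun s w => m - b * X s w.

(* dX_t = m dt - b X_t dt + dW_t with X_0 = x0. *)
Definition ou_solution F (T : R) W (m b x0 : R) X : Prop :=
  [/\ adapted F T X,
      continuous_paths T X,
      (forall w, X 0 w = x0) &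
      ito_process T W (ou_drift m b X) x0 X].

(* Convergence to 0 in probability of nonnegative random variables. *)
Definition cvg0_in_prob (Z : nat -> Omega -> \bar R) : Prop :=
  forall eps : R, 0 < eps ->
    P [set w | (eps%:E <= Z n w)%E] @[n --> \oo] --> 0%E.

(* The integrand \sum_(i < size) coef_i 1_{]time_i, time_(i+1)]}. *)
Record simple_process := SimpleProcess {
  simple_size : nat;
  simple_time : nat -> R;
  simple_coef : nat -> Omega -> R }.

Definition simple_process_on F (T : R) (S : simple_process) : Prop :=
  [/\ simple_time S 0 = 0,
      simple_time S (simple_size S) = T,
      (forall i, (i < simple_size S)%N ->
         simple_time S i <= simple_time S i.+1) &
      (forall i, (i < simple_size S)%N ->
         measurable_wrt (F (simple_time S i)) (simple_coef S i))].

Definition simple_value (S : simple_process) : R -> Omega -> R := fun t w =>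
  \sum_(i < simple_size S)
     simple_coef S i w *
       \1_(`]simple_time S i, simple_time S i.+1] : set R) t.

Definition simple_integral (S : simple_process) W : Omega -> R := fun w =>
  \sum_(i < simple_size S)
     simple_coef S i w * (W (simple_time S i.+1) w - W (simple_time S i) w).

(* [I] is a version of \int_0^T H dW, for H adapted and measurable with
   \int_0^T H_s^2 ds < oo almost surely: the limit in probability of the
   integrals of simple adapted processes S_n such that
   \int_0^T (S_n - H)^2 ds --> 0 in probability. *)
Definition is_ito_integral F (T : R) W H (I : Omega -> R) : Prop :=
  measurable_fun [set: Omega] I /\
  exists S : nat -> simple_process,
    [/\ (forall n, simple_process_on F T (S n)),
        cvg0_in_prob (fun n w =>
          \int[@lebesgue_measure R]_(s in `[0%R, T])
             ((simple_value (S n) s w - H s w) ^+ 2)%R%:E)%E &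
        cvg0_in_prob (fun n w => `|simple_integral (S n) W w - I w|%R%:E)].

(* A version of \int_0^T H dW, with the default 0 when there is none; all
   versions agree almost surely. *)
Definition ito_integral F (T : R) W H : Omega -> R :=
  xget (fun=> 0) [set I | is_ito_integral F T W H I].

(* \int_0^T H dX for an Ito process dX_t = beta_t dt + dW_t. *)
Definition ito_process_integral F (T : R) W (beta : R -> Omega -> R) H :
    Omega -> R := fun w =>
  (\int[@lebesgue_measure R]_(s in `[0%R, T]) (H s w * beta s w))%R +
  ito_integral F T W H w.

(* The Liptser-Shiryaev version, jointly defined in (m, b), of the density at
   the path of [Y] of the law of the solution with parameters (m, b) with
   respect to the law of Y_0 + W. The last argument of [likelihood] is the pair
   (m, b), and [stoch] stands for \int_0^T Y_s dY_s. *)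
Definition likelihood (T : R) (Y : R -> Omega -> R) (stoch : Omega -> R)
    (w : Omega) (p : R * R) : R :=
  expR ((p.1 * (Y T w - Y 0 w) - p.2 * stoch w) -
        2^-1 * (\int[@lebesgue_measure R]_(s in `[0%R, T])
                  (p.1 - p.2 * Y s w) ^+ 2)%R).

End processes.

(* The set of maximizers: a claim that [p] is the maximizer of [L] is the
   equality of [argmax L] with [set p]. *)
Definition argmax (R : realType) (A : Type) (L : A -> R) : set A :=
  [set p | forall q, L q <= L p].

Section estimators.
Context (R : realType).
Variables (T : R) (y : R -> R).

Let I1 : R := (\int[@lebesgue_measure R]_(t in `[0%R, T]) y t)%R.
Let I2 : R := (\int[@lebesgue_measure R]_(t in `[0%R, T]) (y t ^+ 2))%R.

Definition mu_hat : R :=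
  (2^-1 * (y T ^+ 2 - y 0 ^+ 2 - T) * I1 - (y T - y 0) * I2) /
  (I1 ^+ 2 - T * I2).

Definition a_hat : R :=
  (2^-1 * T * (y T ^+ 2 - y 0 ^+ 2 - T) - (y T - y 0) * I1) /
  (I1 ^+ 2 - T * I2).

End estimators.

(* Main.v *)
Require Import Defs.
From HB Require Import structures.
From mathcomp Require Import all_boot all_order all_algebra.
From mathcomp Require Import all_classical all_reals all_analysis.
From mathcomp Require Import measurable_realfun ring lra.

Set Implicit Arguments.
Unset Strict Implicit.
Unset Printing Implicit Defensive.

Import Order.TTheory GRing.Theory Num.Theory.
Import numFieldNormedType.Exports.

Local Open Scope classical_set_scope.
Local Open Scope ring_scope.

(* The exponent of the likelihood is a quadratic polynomial in (m, b). Its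
   quadratic part is positive definite iff the path is not constant on [0, T]
   (strict Cauchy-Schwarz); a constant path would force W_T to take a
   deterministic value, an event of probability 0. The maximizer is then the
   critical point, a rational expression in the integrals of Y and Y^2 and of Y
   against dY, and everything reduces to the identity
     \int_0^T Y_s dY_s = (Y_T^2 - Y_0^2 - T) / 2   almost surely.
   For the Ito integral of Y against dW, this is obtained from left-point sums:
   summation by parts for Y^2 leaves the quadratic variation of W, which tends
   to T in mean square, and errors that vanish by uniform continuity of paths.
   Any other approximation by simple processes has the same limit, because the
   difference of two approximations on a common refinement has a bracket that
   tends to 0 in probability, and Ito sums are controlled by their brackets. *)

(** * Moments of the centred normal law *)

(** The definition of the Ito integral puts no moment condition on simple coefficients, so the
    classical L2 construction does not apply directly. Two devices make up for this. The isometries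
    integrate nonnegative functions only: a whole square is expanded after the Gaussian increment
    has been integrated out, so cross terms vanish without having to be integrable, and both sides
    may be infinite. Brackets then control sums in probability by stopping, the isometry being
    applied to the stopped coefficients alone. As [ito_integral] is an unspecified choice among
    versions, with a default value, both existence of a version and uniqueness up to null sets are
    required before it can be evaluated. The approximating simple processes come with partitions of
    uncontrolled mesh; cutting every cell into equal pieces changes neither the process nor its
    integral, and makes the quadratic variation converge. The true parameters enter only through the
    drift integral, which cancels in the end. *)

Section normal_moments.
Context (R : realType).
Variable s : R.
Hypothesis s_neq0 : s != 0.
Local Notation mu := (@lebesgue_measure R).
Local Notation p := (normal_pdf 0 s).
Local Notation N := (normal_prob 0%R s : probability (measurableTypeR R) R).

(** The change of variables is stated for the Radon-Nikodym derivative; [p] has the same integrals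
    over measurable sets, hence agrees with it almost everywhere. *)
Lemma ge0_integral_normal_prob (f : R -> \bar R) :
  measurable_fun setT f -> (forall x, 0 <= f x)%E ->
  (\int[N]_x f x = \int[mu]_x (f x * (p x)%:E))%E.
Proof.
move=> mf f0.
rewrite -(Radon_Nikodym_SigmaFinite.change_of_variables
            (normal_prob_dominates 0 s)) //.
have dom := normal_prob_dominates 0 s.
apply: ae_eq_integral => //.
- apply: emeasurable_funM => //.
  exact: (measurable_int mu (Radon_Nikodym_SigmaFinite.f_integrable dom)).
- apply: emeasurable_funM => //; apply/measurable_EFinP.
  exact: measurable_normal_pdf.
- apply: ae_eqe_mul2l; apply: integral_ae_eq => //=.
  + exact: (Radon_Nikodym_SigmaFinite.f_integrable dom).
  + by apply/measurable_EFinP; exact: measurable_normal_pdf.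
  + move=> E _ mE.
    by rewrite -Radon_Nikodym_SigmaFinite.f_integral.
Qed.

Lemma is_derive_normal_pdf (x : R) :
  is_derive x 1 p (- (x / s ^+ 2) * p x).
Proof.
rewrite normal_pdfE//.
have H : is_derive x 1 (fun y : R => - (y - 0) ^+ 2 / (s ^+ 2 *+ 2)) (- (x / s^+2)).
  apply: is_derive_eq.
  by rewrite !scaler0 /GRing.scale /= -mulr_natr; field.
rewrite /normal_fun.
apply: is_derive_eq.
by rewrite /GRing.scale /=; ring.
Qed.

Lemma normal_pdf_even (x : R) : p (- x) = p x.
Proof. by rewrite normal_pdfE// /normal_fun !subr0 sqrrN. Qed.

Lemma cvg_cube_normal_pdf : n.+1%:R ^+ 3 * p n.+1%:R @[n --> \oo] --> (0 : R).
Proof.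
(* With [u = x^2 / (2 s^2)], the bound [exp u >= u^2 / 2 = x^4 / (8 s^4)] gives
   [x^3 exp (- u) <= 8 s^4 / x]. *)
set K := normal_peak s * (8 * s ^+ 4).
have K0 : 0 <= K.
  by rewrite mulr_ge0 ?normal_peak_ge0// mulr_ge0// exprn_even_ge0.
apply: (@squeeze_cvgr _ _ _ _ (cst 0) (fun n => K * n.+1%:R^-1)).
- near=> n; apply/andP; split.
    by rewrite mulr_ge0 ?exprn_ge0 ?normal_pdf_ge0.
  rewrite normal_pdfE// /normal_fun subr0 /K.
  set x : R := n.+1%:R.
  have x0 : 0 < x by rewrite ltr0n.
  have u0 : 0 <= x ^+ 2 / (s ^+ 2 *+ 2).
    by rewrite divr_ge0 ?sqr_ge0// mulrn_wge0// sqr_ge0.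
  have := expR_ge1Dxn 1 u0.
  rewrite mulNr expRN; set e := expR _ => eu.
  have s2 : 0 < s ^+ 2 by rewrite exprn_even_gt0.
  have eu' : x ^+ 4 / (8 * s ^+ 4) <= e.
    apply: le_trans eu; rewrite -subr_ge0.
    rewrite (_ : _ - _ = 1) ?ler01//.
    by rewrite -mulr_natr (_ : 2`!%:R = 2 :> R)//; field.
  have e0 : 0 < e by rewrite expR_gt0.
  rewrite mulrCA -(mulrA (normal_peak s)) ler_wpM2l ?normal_peak_ge0//.
  rewrite ler_pdivrMr//.
  apply: (@le_trans _ _ (8 * s ^+ 4 / x * (x ^+ 4 / (8 * s ^+ 4)))).
    rewrite le_eqVlt; apply/orP; left; apply/eqP; field.
    by rewrite s_neq0 gt_eqF.
  apply: ler_wpM2l => //.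
  by apply: divr_ge0; [apply: mulr_ge0 => //; exact: exprn_even_ge0|exact: ltW].
- exact: cvg_cst.
- rewrite -[X in _ --> X](mulr0 K); apply: cvgM; first exact: cvg_cst.
  exact: cvg_harmonic.
Unshelve. all: by end_near. Qed.

(* Stein's identity: [- s^2 r p] is a primitive of [(x r - s^2 r') p]. *)
Lemma integral_normal_stein (q r r' : R -> R) (c : R) :
  continuous q -> (forall x, 0 <= q x) ->
  (forall x : R, is_derive x 1 r (r' x)) ->
  (forall x, q x = c + x * r x - s ^+ 2 * r' x) ->
  (r n.+1%:R - r (- n.+1%:R)) * p n.+1%:R @[n --> \oo] --> (0 : R) ->
  (\int[N]_x (q x)%:E = c%:E)%E.
Proof.
move=> cq q0 dr qE bd.
have mq : measurable_fun setT q by exact: continuous_measurable_fun.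
rewrite ge0_integral_normal_prob; last 2 first.
- exact/measurable_EFinP.
- by move=> x; rewrite lee_fin.
(* Truncation to symmetric intervals: the fundamental theorem of calculus applies on each, evenness
   of [p] merges the two boundary terms into one, and monotone convergence recovers the full
   integrals of [q p] and [p]. *)
pose A n : set R := `[- n.+1%:R, n.+1%:R]%classic.
have AT : \bigcup_n A n = setT.
  rewrite -subTset => x _; exists (Num.truncn `|x|) => //=.
  by rewrite /A/= in_itv/= -ler_norml ltW// truncnS_gt.
have ndA : nondecreasing_seq A.
  apply/nondecreasing_seqP => n; rewrite subsetEset => x /=.
  rewrite /A/= !in_itv/= -!ler_norml => /le_trans; apply.
  by rewrite ler_nat.
have mqp : measurable_fun setT (fun x => (q x)%:E * (p x)%:E)%E.
  by apply: emeasurable_funM; apply/measurable_EFinP => //;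
    exact: measurable_normal_pdf.
have qp0 x : (0 <= (q x)%:E * (p x)%:E)%E.
  by rewrite mule_ge0// lee_fin// normal_pdf_ge0.
have mA n : @measurable _ (measurableTypeR R) (A n) by exact: measurable_itv.
have cvq : (\int[mu]_(x in A n) ((q x)%:E * (p x)%:E) @[n --> \oo] -->
    \int[mu]_x ((q x)%:E * (p x)%:E))%E.
  rewrite -AT; apply: ge0_nondecreasing_set_cvg_integral => //.
  by move=> n; exact: measurable_funTS.
have cvp : (\int[mu]_(x in A n) ((p x)%:E) @[n --> \oo] --> 1)%E.
  rewrite -(integral_normal_pdf 0 s) -AT.
  apply: ge0_nondecreasing_set_cvg_integral => //.
  - move=> n; apply: measurable_funTS; apply/measurable_EFinP.
    exact: measurable_normal_pdf.
  - by move=> n x _; rewrite lee_fin normal_pdf_ge0.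
have ip n : mu.-integrable (A n) (fun x => (p x)%:E).
  apply: (@integrableS _ (measurableTypeR R) _ mu setT) (integrable_normal_pdf 0 s).
  - exact: measurableT.
  - exact: mA.
  - exact: subsetT.

have cp : continuous p by exact: continuous_normal_pdf.
have cqp : continuous (fun x => (q x - c) * p x).
  move=> x; apply: (@cvgM _ _ _ _ (fun x => q x - c)); last exact: cp.
  by apply: cvgB; [exact: cq|exact: cvg_cst].
have FTC n : (\int[mu]_(x in A n) ((q x - c) * p x)%:E =
    (- s ^+ 2 * ((r n.+1%:R - r (- n.+1%:R)) * p n.+1%:R))%:E)%E.
  pose G (x : R) : R := - s ^+ 2 * (r x * p x).
  have dG (x : R) : is_derive x 1 G ((q x - c) * p x).
    have dp := is_derive_normal_pdf x.
    rewrite /G; apply: is_derive_eq.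
    rewrite /GRing.scale /= qE; field => //.
  have cG : continuous G.
    move=> x; apply/differentiable_continuous/derivable1_diffP.
    exact: (@ex_derive _ _ _ _ _ _ _ (dG x)).
  rewrite (@continuous_FTC2 _ (fun x => (q x - c) * p x) G).
  - by rewrite -EFinB /G normal_pdf_even; congr EFin; ring.
  - by rewrite (@lt_trans _ _ 0)// oppr_lt0.
  - exact: continuous_subspaceT.
  - split.
    + by move=> x _; exact: (@ex_derive _ _ _ _ _ _ _ (dG x)).
    + by apply: cvg_at_right_filter; exact: cG.
    + by apply: cvg_at_left_filter; exact: cG.
  - by move=> x _; rewrite derive1E; exact: (@derive_val _ _ _ _ _ _ _ (dG x)).
have eqI n : (\int[mu]_(x in A n) ((q x)%:E * (p x)%:E) =
   (- s ^+ 2 * ((r n.+1%:R - r (- n.+1%:R)) * p n.+1%:R))%:E +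
   c%:E * \int[mu]_(x in A n) ((p x)%:E))%E.
  rewrite -FTC -(integralZl (mA n) (ip n)).
  rewrite -(@integralD _ (measurableTypeR R) _ mu (A n) (mA n)); last 2 first.
  - apply: continuous_compact_integrable; first exact: segment_compact.
    exact: continuous_subspaceT.
  - exact: (integrableZl (mA n) c (ip n)).
  by apply: eq_integral => x _; rewrite -!EFinM -EFinD; congr EFin; ring.
have : ((- s ^+ 2 * ((r n.+1%:R - r (- n.+1%:R)) * p n.+1%:R))%:E +
    c%:E * \int[mu]_(x in A n) ((p x)%:E) @[n --> \oo] --> 0 + c%:E * 1)%E.
  apply: cvgeD => //.
    apply: cvg_EFin; first exact: nearW.
    rewrite /comp /= -[X in _ --> X](mulr0 (- s ^+ 2)).
    by apply: cvgM => //; exact: cvg_cst.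
  exact: cvgeZl.
rewrite add0e mule1 -(funext eqI) => /(cvg_unique _ cvq); exact.
Qed.

Lemma cvg_odd_cubic_normal_pdf (a b : R) :
  (a * n.+1%:R + b * n.+1%:R ^+ 3) * p n.+1%:R @[n --> \oo] --> (0 : R).
Proof.
apply: norm_cvg0.
apply: (@squeeze_cvgr _ _ _ _ (cst 0)
  (fun n => (`|a| + `|b|) * (n.+1%:R ^+ 3 * p n.+1%:R))).
- near=> n; rewrite normr_ge0/= [leRHS]mulrA normrM (ger0_norm (normal_pdf_ge0 _ _ _)).
  rewrite ler_wpM2r ?normal_pdf_ge0//.
  rewrite (le_trans (ler_normD _ _))// (normrM a) (normrM b) mulrDl lerD//.
    rewrite ler_wpM2l// ger0_norm// -[leLHS]expr1 ler_weXn2l//.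
    by rewrite ler1n.
  by rewrite (@ger0_norm _ (_ ^+ 3)) ?exprn_ge0.
- exact: cvg_cst.
- rewrite -[X in _ --> X](mulr0 (`|a| + `|b|)).
  by apply: cvgM; [exact: cvg_cst|exact: cvg_cube_normal_pdf].
Unshelve. all: by end_near. Qed.

(** The constants [a] and [b] will be the values of random variables known at the left end of an
    increment of the Wiener process; the absent term in [a b] expresses that the increment is
    centred. *)
Lemma normal_second_moment (a b : R) :
  (\int[N]_x ((a + b * x) ^+ 2)%:E = (a ^+ 2 + b ^+ 2 * s ^+ 2)%:E)%E.
Proof.
apply: (@integral_normal_stein _ (fun x => 2 * a * b + b ^+ 2 * x)
  (fun=> b ^+ 2)).
- move=> x; apply: (cvg_comp (fun x => a + b * x) (fun y => y ^+ 2));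
    last exact: exprn_continuous.
  by apply: cvgD; [exact: cvg_cst|apply: cvgM; [exact: cvg_cst|exact: cvg_id]].
- by move=> x; exact: sqr_ge0.
- by move=> x; apply: is_derive_eq; rewrite /GRing.scale /= ; ring.
- by move=> x; ring.
- rewrite (_ : (fun n => _) = (fun n =>
      (2 * b ^+ 2 * n.+1%:R + 0 * n.+1%:R ^+ 3) * p n.+1%:R)).
    exact: cvg_odd_cubic_normal_pdf.
  by apply/funext => n; congr (_ * _); ring.
Qed.

(** The centred square [x^2 - s^2] has variance [2 s^4]; [a] will be the value of a partial sum
    known before the increment. *)
Lemma normal_fourth_moment (a : R) :
  (\int[N]_x ((a + (x ^+ 2 - s ^+ 2)) ^+ 2)%:E = (a ^+ 2 + 2 * s ^+ 4)%:E)%E.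
Proof.
apply: (@integral_normal_stein _ (fun x => (2 * a + s ^+ 2) * x + x ^+ 3)
  (fun x => 2 * a + s ^+ 2 + 3 * x ^+ 2)).
- move=> x; apply: (cvg_comp (fun x => a + (x ^+ 2 - s ^+ 2)) (fun y => y ^+ 2));
    last exact: exprn_continuous.
  apply: cvgD; first exact: cvg_cst.
  by apply: cvgB; [exact: exprn_continuous|exact: cvg_cst].
- by move=> x; exact: sqr_ge0.
- by move=> x; apply: is_derive_eq; rewrite /GRing.scale /= ; ring.
- by move=> x; ring.
- rewrite (_ : (fun n => _) = (fun n =>
      (2 * (2 * a + s ^+ 2) * n.+1%:R + 2 * n.+1%:R ^+ 3) * p n.+1%:R)).
    exact: cvg_odd_cubic_normal_pdf.
  by apply/funext => n; congr (_ * _); ring.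
Qed.

End normal_moments.

(** * Independence *)

Section independence.
Context d (Omega : measurableType d) d2 (T2 : measurableType d2)
  (R : realType) (P : probability Omega R).

(** Independence on rectangles identifies the joint law with the product of the marginal laws, and
    Tonelli splits the integral. *)
Lemma ge0_integral_indep (X : Omega -> T2) (V : Omega -> R)
    (f : T2 * R -> \bar R) :
  measurable_fun setT X -> measurable_fun setT V ->
  (forall (A : set T2) (B : set R), measurable A -> measurable B ->
     P (X @^-1` A `&` V @^-1` B) = (P (X @^-1` A) * P (V @^-1` B))%E) ->
  measurable_fun setT f -> (forall z, 0 <= f z)%E ->
  (\int[P]_w f (X w, V w) = \int[P]_w \int[P]_v f (X w, V v))%E.
Proof.
move=> mX mV XV mf f0.
pose X' : {mfun Omega >-> T2} := HB.pack X (isMeasurableFun.Build _ _ _ _ X mX).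
pose V' : {mfun Omega >-> R} := HB.pack V (isMeasurableFun.Build _ _ _ _ V mV).
have mXV : measurable_fun setT (fun w => (X w, V w)).
  exact: measurable_fun_pair.
pose XV' : {mfun Omega >-> (T2 * R)%type} :=
  HB.pack (fun w => (X w, V w)) (isMeasurableFun.Build _ _ _ _ _ mXV).
rewrite -[LHS](@ge0_integral_distribution _ _ _ _ _ P XV' f)//.
rewrite (@eq_measure_integral _ _ _ setT (distribution P X' \x distribution P V')%E);
    last first.
  by move=> A mA _; apply/esym/product_measure_unique => //= B C mB mC; exact: XV.
rewrite fubini_tonelli1//.
rewrite ge0_integral_distribution//; last 2 first.
- exact: measurable_fun_fubini_tonelli_F.
- by move=> x; exact: integral_ge0.
apply: eq_integral => w _; rewrite /= /fubini_F.
rewrite ge0_integral_distribution//.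
exact: measurableT_comp.
Qed.

End independence.

(** * Measurability with respect to a sub-sigma-algebra *)

Section measurability_wrt.
Context d (Omega : measurableType d) d1 (T1 : measurableType d1)
  d2 (T2 : measurableType d2).

(** This is [measurable_wrt] with an arbitrary target space, so that it covers pairs of variables
    known at the same time. *)
Definition sub_measurable (G : set (set Omega)) (X : Omega -> T1) :=
  forall B : set T1, measurable B -> G (X @^-1` B).

Lemma sub_measurable_comp G (X : Omega -> T1) (f : T1 -> T2) :
  measurable_fun setT f -> sub_measurable G X ->
  forall B : set T2, measurable B -> G ((f \o X) @^-1` B).
Proof.
move=> mf GX B mB; rewrite comp_preimage; apply: GX.
by rewrite -[X in measurable X]setTI; exact: mf.
Qed.

Lemma sub_measurable_fun G (X : Omega -> T1) :
  G `<=` measurable -> sub_measurable G X -> measurable_fun setT X.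
Proof. by move=> Gm GX _ B mB; rewrite setTI; apply/Gm/GX. Qed.

End measurability_wrt.

Lemma sub_measurable_pair d (Omega : measurableType d) d1
    (T1 : measurableType d1) d2 (T2 : measurableType d2) (G : set (set Omega))
    (X : Omega -> T1) (Y : Omega -> T2) :
  sigma_algebra setT G -> sub_measurable G X -> sub_measurable G Y ->
  sub_measurable G (fun w => (X w, Y w)).
Proof.
move=> sG GX GY B mB.
(* Being a sigma-algebra, [G] equals the one it generates, so measurability for
   [g_sigma_algebraType G] is membership of preimages in [G]. *)
have E : <<s G >> = G by exact: sigma_algebra_id.
have mf (d' : measure_display) (T' : measurableType d') (Z : Omega -> T') :
    sub_measurable G Z ->
    @measurable_fun _ _ (g_sigma_algebraType G) T' setT Z.
  by move=> GZ _ C mC; rewrite setTI /measurable /= E; exact: GZ.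
have := @measurable_fun_pair _ _ _ (g_sigma_algebraType G) T1 T2 X Y
  (mf _ _ _ GX) (mf _ _ _ GY) measurableT B mB.
by rewrite setTI /measurable /= E.
Qed.

Lemma sub_measurable_fun2 d (Omega : measurableType d) (R : realType)
    (G : set (set Omega)) (f : R * R -> R) (X Y : Omega -> R) :
  sigma_algebra setT G -> measurable_fun setT f ->
  measurable_wrt G X -> measurable_wrt G Y ->
  measurable_wrt G (fun w => f (X w, Y w)).
Proof.
move=> sG mf GX GY.
exact: (sub_measurable_comp mf (sub_measurable_pair sG GX GY)).
Qed.

(** * Wiener increments and the past *)

Section wiener.
Context (R : realType) (d : measure_display) (Omega : measurableType d)
  (P : probability Omega R) (T : R) (F : R -> set (set Omega))
  (W : R -> Omega -> R).
Hypothesis F_filtration : filtration F T.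
Hypothesis W_wiener : wiener_process P F T W.

Lemma filtration_sigma_algebra t : 0 <= t <= T -> sigma_algebra setT (F t).
Proof. by move=> t0T; have [/(_ t t0T)[]] := F_filtration. Qed.

Lemma filtration_measurable t : 0 <= t <= T -> F t `<=` measurable.
Proof. by move=> t0T; have [/(_ t t0T)[]] := F_filtration. Qed.

Lemma measurable_wrtS s t (X : Omega -> R) : 0 <= s -> s <= t -> t <= T ->
  measurable_wrt (F s) X -> measurable_wrt (F t) X.
Proof.
move=> s0 st tT FX B mB; have [_ FS] := F_filtration.
exact/(FS _ _ s0 st tT)/FX.
Qed.

Lemma measurable_wrt_fun t (X : Omega -> R) : 0 <= t <= T ->
  measurable_wrt (F t) X -> measurable_fun setT X.
Proof.
by move=> t0T; apply: sub_measurable_fun; exact: filtration_measurable.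
Qed.

Lemma adapted_measurable_fun (X : R -> Omega -> R) t : adapted F T X ->
  0 <= t <= T -> measurable_fun setT (X t).
Proof. by move=> FX t0T; apply: (measurable_wrt_fun t0T); exact: FX. Qed.

Lemma wiener_measurable_fun t : 0 <= t <= T -> measurable_fun setT (W t).
Proof. by apply: adapted_measurable_fun; case: W_wiener. Qed.

Lemma wiener_increment_measurable (s t : R) : 0 <= s -> s <= t -> t <= T ->
  measurable_fun setT (W t \- W s).
Proof.
move=> s0 st tT; apply: measurable_funB; apply: wiener_measurable_fun.
  by rewrite tT (le_trans s0 st).
by rewrite s0 (le_trans st tT).
Qed.

(** The freezing lemma: [X] belongs to the past and the increment is independent of it, so the
    increment is integrated out with [X] held fixed. This does the work of conditional expectation
    given [F s]. *)
Lemma ge0_integral_wiener_increment d2 (T2 : measurableType d2) (s t : R)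
    (X : Omega -> T2) (f : T2 * R -> \bar R) : 0 <= s -> s < t -> t <= T ->
  sub_measurable (F s) X ->
  measurable_fun setT f -> (forall z, 0 <= f z)%E ->
  (\int[P]_w f (X w, (W t w - W s w)%R) =
   \int[P]_w \int[normal_prob 0%R (Num.sqrt (t - s))]_y f (X w, y))%E.
Proof.
move=> s0 st tT FX mf f0; have [_ _ _ WN Windep] := W_wiener.
have mW := wiener_increment_measurable s0 (ltW st) tT.
have sT : 0 <= s <= T by rewrite s0 (le_trans (ltW st)).
have mX : measurable_fun setT X.
  by apply: sub_measurable_fun FX; exact: filtration_measurable.
rewrite [LHS](ge0_integral_indep (V := W t \- W s) mX mW)//; last first.
  by move=> A B mA mB; apply: Windep => //; exact: FX.
apply: eq_integral => w _.
have mW' : @measurable_fun _ _ _ (measurableTypeR R) setT (W t \- W s).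
  exact: mW.
pose V' : {mfun Omega >-> measurableTypeR R} :=
  HB.pack (W t \- W s : Omega -> measurableTypeR R)
    (isMeasurableFun.Build _ _ _ (measurableTypeR R) _ mW').
have mfX : measurable_fun setT (fun y : R => f (X w, y)).
  exact: measurableT_comp.
have mfX' : @measurable_fun _ _ (measurableTypeR R) _ setT (fun y => f (X w, y)).
  exact: mfX.
rewrite -[LHS](@ge0_integral_distribution _ _ _ _ _ P V' (fun y => f (X w, y)))//.
apply: (@eq_measure_integral _ (measurableTypeR R) _ setT
  (normal_prob 0 (Num.sqrt (t - s)))).
by move=> A mA _; exact: WN.
Qed.

Lemma integral_wiener_increment2 (s t : R) (M D : Omega -> R) :
  0 <= s -> s <= t -> t <= T ->
  measurable_wrt (F s) M -> measurable_wrt (F s) D ->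
  (\int[P]_w ((M w + D w * (W t w - W s w)) ^+ 2)%:E =
   \int[P]_w (M w ^+ 2 + D w ^+ 2 * (t - s))%:E)%E.
Proof.
(* Partitions may repeat points, and the Gaussian law of increments is given for [s < t] only; when
   [s = t] the increment is 0. *)
move=> s0; rewrite le_eqVlt => /predU1P[<- _ _ _|st tT FM FD].
  by apply: eq_integral => w _; rewrite !subrr !mulr0 !addr0.
have sT : 0 <= s <= T by rewrite s0 (le_trans (ltW st)).
have sq : Num.sqrt (t - s) != 0 by rewrite gt_eqF// sqrtr_gt0 subr_gt0.
rewrite [LHS](@ge0_integral_wiener_increment _ (R * R)%type s t
  (fun w => (M w, D w)) (fun z => ((z.1.1 + z.1.2 * z.2) ^+ 2)%:E))//.
- apply: eq_integral => w _ /=.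
  by rewrite normal_second_moment// sqr_sqrtr// subr_ge0 ltW.
- by apply: sub_measurable_pair => //; exact: filtration_sigma_algebra.
- apply/measurable_EFinP; apply: measurable_funX; apply: measurable_funD.
    exact: measurableT_comp.
  apply: measurable_funM => //.
  exact: measurableT_comp.
- by move=> z; rewrite lee_fin sqr_ge0.
Qed.

Lemma integral_wiener_increment4 (s t : R) (M : Omega -> R) :
  0 <= s -> s <= t -> t <= T -> measurable_wrt (F s) M ->
  (\int[P]_w ((M w + ((W t w - W s w) ^+ 2 - (t - s))) ^+ 2)%:E =
   \int[P]_w (M w ^+ 2 + 2 * (t - s) ^+ 2)%:E)%E.
Proof.
move=> s0; rewrite le_eqVlt => /predU1P[<- _ _|st tT FM].
  by apply: eq_integral => w _; rewrite !subrr !expr0n/= !(mulr0, subr0, addr0).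
have sq : Num.sqrt (t - s) != 0 by rewrite gt_eqF// sqrtr_gt0 subr_gt0.
have sq2 : Num.sqrt (t - s) ^+ 2 = t - s by rewrite sqr_sqrtr// subr_ge0 ltW.
rewrite [LHS](@ge0_integral_wiener_increment _ R s t
  M (fun z => ((z.1 + (z.2 ^+ 2 - (t - s))) ^+ 2)%:E))//.
- apply: eq_integral => w _ /=; have := normal_fourth_moment sq (M w).
  by rewrite -[4%N]/(2 * 2)%N exprM sq2.
- apply/measurable_EFinP; apply: measurable_funX; apply: measurable_funD => //.
  apply: measurable_funB => //; exact: measurable_funX.
- by move=> z; rewrite lee_fin sqr_ge0.
Qed.

End wiener.

(** * Sums of Wiener increments along a partition *)

Definition grid (R : realType) (T : R) (N : nat) (tau : nat -> R) :=
  [/\ tau 0%N = 0, tau N = T & forall i, (i < N)%N -> tau i <= tau i.+1].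

Section grid_theory.
Context (R : realType) (T : R) (N : nat) (tau : nat -> R).
Hypothesis tau_grid : grid T N tau.

Lemma grid_le i j : (i <= j)%N -> (j <= N)%N -> tau i <= tau j.
Proof.
have [_ _ tauS] := tau_grid.
elim: j => [|j IH]; first by rewrite leqn0 => /eqP ->.
rewrite leq_eqVlt => /predU1P[-> //|ij jN].
by apply: le_trans (tauS _ jN); apply: IH => //; exact: ltnW.
Qed.

Lemma grid_itv i : (i <= N)%N -> 0 <= tau i <= T.
Proof.
have [t0 tT _] := tau_grid => iN.
by have := grid_le (leq0n i) iN; have := grid_le iN (leqnn N); rewrite t0 tT => -> ->.
Qed.

Lemma grid_step_ge0 i : (i < N)%N -> 0 <= tau i.+1 - tau i.
Proof. by rewrite subr_ge0 => iN; exact: grid_le. Qed.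

Lemma grid_sum_steps : \sum_(k < N) (tau k.+1 - tau k) = T.
Proof.
have [t0 tT _] := tau_grid.
by rewrite -(big_mkord xpredT (fun k => tau k.+1 - tau k)) telescope_sumr// t0 tT subr0.
Qed.

End grid_theory.

Section wiener_sums.
Context (R : realType) (d : measure_display) (Omega : measurableType d)
  (P : probability Omega R) (T : R) (F : R -> set (set Omega))
  (W : R -> Omega -> R).
Hypothesis F_filtration : filtration F T.
Hypothesis W_wiener : wiener_process P F T W.
Context (N : nat) (tau : nat -> R).
Hypothesis tau_grid : grid T N tau.

Local Notation dW k w := (W (tau k.+1) w - W (tau k) w).
Local Notation h k := (tau k.+1 - tau k).

Lemma measurable_wrt_sum (X : nat -> Omega -> R) n : (n <= N)%N ->
  (forall k, (k < n)%N -> measurable_wrt (F (tau n)) (X k)) ->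
  measurable_wrt (F (tau n)) (fun w => \sum_(k < n) X k w).
Proof.
move=> nN FX.
have sF : sigma_algebra setT (F (tau n)).
  by apply: (filtration_sigma_algebra F_filtration); exact: grid_itv nN.
suff : forall m, (m <= n)%N ->
    measurable_wrt (F (tau n)) (fun w => \sum_(k < m) X k w) by exact.
elim=> [_|m IH mn].
  rewrite (_ : (fun w => _) = (fun=> 0)); last first.
    by apply/funext => w; rewrite big_ord0.
  move=> B mB; rewrite preimage_cst; case: ifP => _.
    rewrite -setC0 -setTD; case: sF => F0 FC _; exact: FC.
  by case: sF.
rewrite (_ : (fun w => _) = (fun w => \sum_(k < m) X k w + X m w)); last first.
  by apply/funext => w; rewrite big_ord_recr.
apply: (@sub_measurable_fun2 _ _ _ _ (fun z => z.1 + z.2)) => //.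
- exact: measurable_funD.
- by apply: IH; exact: ltnW.
- exact: FX.
Qed.

(** The free [g] serves both the terms [D k * dW k] of Ito sums and the terms [dW k ^+ 2 - h k] of
    the quadratic variation. *)
Lemma wiener_increment_wrt k n (D : Omega -> R) (g : R * R -> R) :
  (k < n)%N -> (n <= N)%N -> measurable_fun setT g ->
  measurable_wrt (F (tau k)) D ->
  measurable_wrt (F (tau n)) (fun w => g (D w, dW k w)).
Proof.
move=> kn nN mg FD.
have itv i : (i <= N)%N -> 0 <= tau i <= T by exact: grid_itv.
have [adW _ _ _ _] := W_wiener.
have FS (i : nat) (Z : Omega -> R) : (i <= n)%N ->
    measurable_wrt (F (tau i)) Z -> measurable_wrt (F (tau n)) Z.
  move=> ni; apply: (measurable_wrtS F_filtration).
  - by have /andP[] := itv _ (leq_trans ni nN).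
  - exact: (grid_le tau_grid ni nN).
  - by have /andP[] := itv _ nN.
have sF : sigma_algebra setT (F (tau n)).
  by apply: (filtration_sigma_algebra F_filtration); exact: itv.
apply: (@sub_measurable_fun2 _ _ _ _ g _ _ sF mg).
  by apply: (FS k) => //; exact: ltnW.
apply: (@sub_measurable_fun2 _ _ _ _ (fun z => z.1 - z.2) _ _ sF).
- exact: measurable_funB.
- by apply: (FS k.+1) => //; apply: adW; exact: itv (leq_trans kn nN).
- apply: (FS k); first exact: ltnW.
  by apply: adW; apply: itv; exact: ltnW (leq_trans kn nN).
Qed.

(** Induction on the number of increments: the partial sum and the next coefficient are frozen while
    the next increment is integrated out. Coefficients are merely adapted, so both sides may be
    infinite. *)
Lemma discrete_ito_isometry (D : nat -> Omega -> R) :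
  (forall k, (k < N)%N -> measurable_wrt (F (tau k)) (D k)) ->
  (\int[P]_w ((\sum_(k < N) D k w * dW k w) ^+ 2)%:E =
   \int[P]_w (\sum_(k < N) D k w ^+ 2 * h k)%:E)%E.
Proof.
move=> FD; suff : forall n, (n <= N)%N ->
  (\int[P]_w ((\sum_(k < n) D k w * dW k w) ^+ 2)%:E =
   \int[P]_w (\sum_(k < n) D k w ^+ 2 * h k)%:E)%E by exact.
have itv i : (i <= N)%N -> 0 <= tau i <= T by exact: grid_itv.
have mD k : (k < N)%N -> measurable_fun setT (D k).
  by move=> kN; apply: (measurable_wrt_fun F_filtration (itv _ (ltnW kN))); exact: FD.
elim=> [_|n IH nN].
  by apply: eq_integral => w _; rewrite !big_ord0 expr0n.
have FM : measurable_wrt (F (tau n)) (fun w => \sum_(k < n) D k w * dW k w).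
  apply: (@measurable_wrt_sum (fun k w => D k w * dW k w)) => [|k kn].
    exact: ltnW.
  apply: (@wiener_increment_wrt k n (D k) (fun z => z.1 * z.2)) => //.
  - exact: ltnW.
  - exact: measurable_funM.
  - by apply: FD; exact: ltn_trans kn nN.
have mM := measurable_wrt_fun F_filtration (itv _ (ltnW nN)) FM.
have -> : (fun w => ((\sum_(k < n.+1) D k w * dW k w) ^+ 2)%:E) =
    (fun w => ((\sum_(k < n) D k w * dW k w + D n w * dW n w) ^+ 2)%:E).
  by apply/funext => w; rewrite big_ord_recr.
rewrite (integral_wiener_increment2 F_filtration W_wiener _ _ _ FM (FD _ nN));
  last 3 first.
- by have /andP[] := itv _ (ltnW nN).
- exact: (grid_le tau_grid).
- by have /andP[] := itv _ nN.
have hn := grid_step_ge0 tau_grid nN.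
have mDn : measurable_fun setT (fun w => D n w ^+ 2 * h n).
  by apply: measurable_funM => //; apply: measurable_funX; exact: mD.
have mS : measurable_fun setT (fun w => \sum_(k < n) D k w ^+ 2 * h k).
  apply: measurable_sum => k; apply: measurable_funM => //.
  by apply: measurable_funX; apply: mD; exact: ltn_trans (ltn_ord k) nN.
under eq_integral do rewrite EFinD.
rewrite ge0_integralD//=; last 4 first.
- by move=> w _; rewrite lee_fin sqr_ge0.
- by apply/measurable_EFinP; exact: measurable_funX.
- by move=> w _; rewrite lee_fin mulr_ge0// sqr_ge0.
- exact/measurable_EFinP.
rewrite IH ?(ltnW nN)// -ge0_integralD//=; last 4 first.
- move=> w _; rewrite lee_fin sumr_ge0// => k _; rewrite mulr_ge0// ?sqr_ge0//.
  by apply: (grid_step_ge0 tau_grid); exact: ltn_trans (ltn_ord k) nN.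
- exact/measurable_EFinP.
- by move=> w _; rewrite lee_fin mulr_ge0// sqr_ge0.
- exact/measurable_EFinP.
by apply: eq_integral => w _; rewrite big_ord_recr.
Qed.

(** The variables [dW k ^+ 2 - h k] are centred given the past, hence orthogonal, and each has
    variance [2 * h k ^+ 2]. *)
Lemma wiener_quadratic_variation_variance :
  (\int[P]_w ((\sum_(k < N) (dW k w ^+ 2 - h k)) ^+ 2)%:E =
   (\sum_(k < N) 2 * h k ^+ 2)%:E)%E.
Proof.
suff : forall n, (n <= N)%N ->
  (\int[P]_w ((\sum_(k < n) (dW k w ^+ 2 - h k)) ^+ 2)%:E =
   (\sum_(k < n) 2 * h k ^+ 2)%:E)%E by exact.
have itv i : (i <= N)%N -> 0 <= tau i <= T by exact: grid_itv.
elim=> [_|n IH nN].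
  under eq_integral do rewrite big_ord0 expr0n/=.
  by rewrite integral0 big_ord0.
have FM : measurable_wrt (F (tau n)) (fun w => \sum_(k < n) (dW k w ^+ 2 - h k)).
  apply: (@measurable_wrt_sum (fun k w => dW k w ^+ 2 - h k)) => [|k kn].
    exact: ltnW.
  (* [W (tau k)] is a placeholder: the function ignores its first argument. *)
  apply: (@wiener_increment_wrt k n (W (tau k)) (fun z => z.2 ^+ 2 - h k)) => //.
  - exact: ltnW.
  - by apply: measurable_funB => //; exact: measurable_funX.
  - have [adW _ _ _ _] := W_wiener; apply: adW; apply: itv.
    exact: ltnW (ltn_trans kn nN).
have mM := measurable_wrt_fun F_filtration (itv _ (ltnW nN)) FM.
have -> : (fun w => ((\sum_(k < n.+1) (dW k w ^+ 2 - h k)) ^+ 2)%:E) =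
    (fun w => ((\sum_(k < n) (dW k w ^+ 2 - h k) +
                (dW n w ^+ 2 - h n)) ^+ 2)%:E).
  by apply/funext => w; rewrite big_ord_recr.
rewrite (integral_wiener_increment4 F_filtration W_wiener _ _ _ FM); last 3 first.
- by have /andP[] := itv _ (ltnW nN).
- exact: (grid_le tau_grid).
- by have /andP[] := itv _ nN.
under eq_integral do rewrite EFinD.
rewrite ge0_integralD//=; last 3 first.
- by move=> w _; rewrite lee_fin sqr_ge0.
- by apply/measurable_EFinP; exact: measurable_funX.
- by move=> w _; rewrite lee_fin mulr_ge0// sqr_ge0.
rewrite IH ?(ltnW nN)// integral_cst//.
rewrite [X in (_ + _ * X)%E](_ : _ = 1%E); last exact: probability_setT.
rewrite mule1 -EFinD.
by rewrite big_ord_recr.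
Qed.

End wiener_sums.

(** * Convergence in probability *)

Lemma cvge0P (R : realType) (u : nat -> \bar R) : (forall n, 0 <= u n)%E ->
  (u @ \oo --> 0%E) <->
  (forall e : R, 0 < e -> \forall n \near \oo, (u n <= e%:E)%E).
Proof.
move=> u0; split=> [/fine_cvgP[ufin /cvgr0Pnorm_le ucv] e e0|ue].
  near=> n.
  have un : u n \is a fin_num by near: n.
  rewrite -(fineK un) lee_fin.
  apply: (le_trans (ler_norm _)).
  by near: n; exact: ucv.
apply/fine_cvgP; split.
  near=> n; rewrite ge0_fin_numE//.
  by apply: (@le_lt_trans _ _ 1%:E); [near: n; exact: ue|exact: ltry].
apply/cvgr0Pnorm_le => e e0; near=> n.
rewrite ger0_norm ?fine_ge0//= -lee_fin fineK; first by near: n; exact: ue.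
rewrite ge0_fin_numE//.
by apply: (@le_lt_trans _ _ 1%:E); [near: n; exact: ue|exact: ltry].
Unshelve. all: by end_near. Qed.

Section convergence_in_probability.
Context (R : realType) (d : measure_display) (Omega : measurableType d)
  (P : probability Omega R).
Implicit Types (Z : nat -> Omega -> \bar R).

Lemma measurable_superlevel (Z : Omega -> \bar R) (e : \bar R) :
  measurable_fun setT Z -> measurable [set w | (e <= Z w)%E].
Proof. by move=> mZ; rewrite -[X in measurable X]setTI; exact: emeasurable_fun_c_infty. Qed.

Lemma ae_le_measure (A B : set Omega) : measurable A -> measurable B ->
  {ae P, forall w, A w -> B w} -> (P A <= P B)%E.
Proof.
move=> mA mB [N [mN N0 subN]].
have -> : (P B = P B + P N)%E by rewrite N0 adde0.
apply: le_trans (measureU2 _ mB mN).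
apply: le_measure; rewrite ?inE//; first exact: measurableU.
move=> w Aw; have [Bw|nBw] := pselect (B w); first by left.
by right; apply: subN => /= /(_ Aw).
Qed.

Lemma cvg0_in_prob_le Z Z' :
  (forall n, measurable_fun setT (Z n)) ->
  (forall n, measurable_fun setT (Z' n)) ->
  (forall n, {ae P, forall w, (Z n w <= Z' n w)%E}) ->
  cvg0_in_prob P Z' -> cvg0_in_prob P Z.
Proof.
move=> mZ mZ' ZZ' Z'0 e e0.
apply/cvge0P => [n|x x0]; first exact: measure_ge0.
have /cvge0P-/(_ (fun=> measure_ge0 _ _)) H := Z'0 _ e0.
near=> n; apply: (@le_trans _ _ (P [set w | (e%:E <= Z' n w)%E])); last first.
  by near: n; exact: H.
apply: ae_le_measure; [exact: measurable_superlevel..|].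
have := ZZ' n; apply: filterS => w ZZ'w /=.
by move/le_trans; apply.
Unshelve. all: by end_near. Qed.

Lemma cvg0_in_probD Z Z' :
  (forall n, measurable_fun setT (Z n)) ->
  (forall n, measurable_fun setT (Z' n)) ->
  cvg0_in_prob P Z -> cvg0_in_prob P Z' ->
  cvg0_in_prob P (fun n w => Z n w + Z' n w)%E.
Proof.
move=> mZ mZ' Z0 Z'0 e e0.
apply/cvge0P => [n|x x0]; first exact: measure_ge0.
have e20 : 0 < e / 2 by rewrite divr_gt0.
have x20 : 0 < x / 2 by rewrite divr_gt0.
have /cvge0P-/(_ (fun=> measure_ge0 _ _)) /(_ _ x20) H := Z0 _ e20.
have /cvge0P-/(_ (fun=> measure_ge0 _ _)) /(_ _ x20) H' := Z'0 _ e20.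
near=> n; rewrite [x]splitr EFinD.
have mA := measurable_superlevel (e / 2)%:E (mZ n).
have mB := measurable_superlevel (e / 2)%:E (mZ' n).
apply: (@le_trans _ _ (P [set w | ((e / 2)%:E <= Z n w)%E] +
                       P [set w | ((e / 2)%:E <= Z' n w)%E])%E); last first.
  by apply: leeD; near: n.
apply: le_trans (measureU2 _ mA mB).
apply: le_measure; rewrite ?inE//.
- by apply: measurable_superlevel; exact: emeasurable_funD.
- exact: measurableU.
- move=> w /= eZ; have [?|Zw] := leP (e / 2)%:E (Z n w); first by left.
  right; rewrite leNgt; apply/negP => Z'w; move: eZ.
  by rewrite leNgt [e in (_ < e%:E)%E]splitr EFinD lteD//.
Unshelve. all: by end_near. Qed.

Lemma cvg0_in_probMl (c : R) Z : 0 <= c ->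
  (forall n, measurable_fun setT (Z n)) ->
  (forall n w, 0 <= Z n w)%E ->
  cvg0_in_prob P Z -> cvg0_in_prob P (fun n w => c%:E * Z n w)%E.
Proof.
rewrite le_eqVlt => /predU1P[<-{c} mZ Zge0 Z0 e e0|c0 mZ Zge0 Z0 e e0].
  rewrite (_ : (fun n => _) = (fun=> 0%E)); first exact: cvg_cst.
  apply/funext => n; rewrite (_ : [set w | _] = set0) ?measure0//.
  by apply/seteqP; split=> [w /=|//]; rewrite mul0e lee_fin leNgt e0.
rewrite (_ : (fun n => _) = (fun n => P [set w | ((e / c)%:E <= Z n w)%E])).
  by apply: Z0; rewrite divr_gt0.
apply/funext => n; congr (P _); apply/funext => w /=; apply/propext.
by rewrite EFinM lee_pdivrMr// muleC.
Qed.

(** Along almost every path the indicator of the superlevel set is eventually 0; dominated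
    convergence with bound 1 concludes. *)
Lemma cvg0_in_prob_ae Z :
  (forall n, measurable_fun setT (Z n)) ->
  {ae P, forall w, forall e : R, 0 < e -> \forall n \near \oo, (Z n w < e%:E)%E} ->
  cvg0_in_prob P Z.
Proof.
move=> mZ Z0 e e0.
pose A n := [set w | (e%:E <= Z n w)%E].
have mA n : measurable (A n) by exact: measurable_superlevel.
have [||||_ _] := @dominated_convergence _ _ _ P setT measurableT
  (fun n w => (\1_(A n) w)%:E) (cst 0%E) (cst 1%E) _ (measurable_cst _).
- by move=> n; apply/measurable_EFinP; exact: measurable_indic.
- apply: filterS Z0 => w Z0w _.
  apply: cvg_near_cst.
  have := Z0w _ e0; apply: filterS => n Zne; rewrite indicE memNset//= /A /=.
  by apply/negP; rewrite -ltNge.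
- exact: finite_measure_integrable_cst.
- apply: aeW => w n _; rewrite /= lee_fin indicE.
  by case: (_ \in _); rewrite ?normr1 ?normr0.
rewrite integral0 => H; apply: cvg_trans; last exact: H.
apply: near_eq_cvg; near=> n => /=.
by rewrite integral_indic// setIT.
Unshelve. all: by end_near. Qed.

(** The constant sequence [|X - Y|] tends to 0 in probability, so its superlevel sets at positive
    levels are null; the countably many levels [1 / (n + 1)] suffice. *)
Lemma cvg0_in_prob_unique (X Y : Omega -> R) Z Z' :
  measurable_fun setT X -> measurable_fun setT Y ->
  (forall n, measurable_fun setT (Z n)) ->
  (forall n, measurable_fun setT (Z' n)) ->
  (forall n w, (`|X w - Y w|%:E <= Z n w + Z' n w)%E) ->
  cvg0_in_prob P Z -> cvg0_in_prob P Z' ->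
  {ae P, forall w, X w = Y w}.
Proof.
move=> mX mY mZ mZ' XY Z0 Z'0.
have mXY : measurable_fun setT (fun w => (`|X w - Y w|)%:E).
  by apply/measurable_EFinP; apply: measurableT_comp => //; exact: measurable_funB.
have : cvg0_in_prob P (fun _ w => `|X w - Y w|%:E).
  apply: (cvg0_in_prob_le _ _ _ (cvg0_in_probD mZ mZ' Z0 Z'0)) => //.
  - by move=> n; exact: emeasurable_funD.
  - by move=> n; apply: aeW => w; exact: XY.
move=> XY0.
have H n : {ae P, forall w, `|X w - Y w| < n.+1%:R^-1}.
  exists [set w | (n.+1%:R^-1%:E <= `|X w - Y w|%:E)%E]; split.
  - exact: measurable_superlevel.
  - have /cvg_lim <- // := XY0 n.+1%:R^-1 (ltac:(by rewrite invr_gt0)).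
    by apply/esym/cvg_lim => //; exact: cvg_cst.
  - by move=> w /= /negP; rewrite -leNgt lee_fin.
have := ae_foralln H; apply: filterS => w Hw.
apply/eqP; rewrite -subr_eq0 -normr_le0 leNgt; apply/negP => XYw.
have := Hw (Num.truncn (`|X w - Y w|^-1)); apply/negP; rewrite -leNgt.
rewrite -[leRHS]invrK lef_pV2 ?posrE ?invr_gt0//.
by rewrite ltW// truncnS_gt.
Qed.

End convergence_in_probability.

(** * Ito sums in probability *)

Section ito_sums_in_probability.
Context (R : realType) (d : measure_display) (Omega : measurableType d)
  (P : probability Omega R) (T : R) (F : R -> set (set Omega))
  (W : R -> Omega -> R).
Hypothesis F_filtration : filtration F T.
Hypothesis W_wiener : wiener_process P F T W.

Local Notation dW tau k w := (W (tau k.+1) w - W (tau k) w).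
Local Notation h tau k := (tau k.+1 - tau k).

Lemma chebyshev2 (X : Omega -> R) (c eps : R) : measurable_fun setT X ->
  0 < eps -> (\int[P]_w (X w ^+ 2)%:E <= c%:E)%E ->
  (P [set w | (eps%:E <= `|X w|%:E)%E] <= (c / eps ^+ 2)%:E)%E.
Proof.
move=> mX e0 Xc.
have e20 : 0 < eps ^+ 2 by rewrite exprn_gt0.
rewrite EFinM lee_pdivlMr// muleC; apply: le_trans Xc.
have mX2 : measurable_fun setT (fun w => (X w ^+ 2)%:E).
  by apply/measurable_EFinP; exact: measurable_funX.
have := @le_integral_abse _ _ _ P setT measurableT _ (eps ^+ 2) mX2 e20.
rewrite setTI.
rewrite (_ : [set w | _] = [set w | (eps%:E <= `|X w|%:E)%E]); last first.
  apply/funext => w /=; apply/propext.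
  rewrite !lee_fin ger0_norm ?sqr_ge0// -[X w ^+ 2]real_normK ?num_real//.
  by rewrite ler_pXn2r// nnegrE// ltW.
move/le_trans; apply; apply: ge0_le_integral => //.
- exact: measurableT_comp.
- by move=> w _ /=; rewrite ger0_norm// sqr_ge0.
Qed.

Section one_grid.
Context (N : nat) (tau : nat -> R).
Hypothesis tau_grid : grid T N tau.
Variable D : nat -> Omega -> R.
Hypothesis FD : forall k, (k < N)%N -> measurable_wrt (F (tau k)) (D k).

Let itv i : (i <= N)%N -> 0 <= tau i <= T.
Proof. exact: grid_itv. Qed.

Lemma measurable_ito_sum :
  measurable_fun setT (fun w => \sum_(k < N) D k w * dW tau k w).
Proof.
apply: measurable_sum => k; apply: measurable_funM.
  by apply: (measurable_wrt_fun F_filtration (itv (ltnW (ltn_ord k)))); exact: FD.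
by apply: measurable_funB; apply: (wiener_measurable_fun F_filtration W_wiener);
  apply: itv => //; exact: ltnW.
Qed.

Lemma measurable_ito_bracket n : (n <= N)%N ->
  measurable_fun setT (fun w => \sum_(k < n) D k w ^+ 2 * h tau k).
Proof.
move=> nN; apply: measurable_sum => k; apply: measurable_funM => //.
have kN : (k < N)%N by exact: leq_trans (ltn_ord k) nN.
apply: measurable_funX.
by apply: (measurable_wrt_fun F_filtration (itv (ltnW kN))); exact: FD.
Qed.

(* The coefficients are stopped when the bracket exceeds [delta], so that the
   isometry applies to them with a bracket bounded by [delta]. *)
Lemma ito_sum_tail (eps delta : R) : 0 < eps -> 0 < delta ->
  (P [set w | (eps%:E <= `|\sum_(k < N) D k w * dW tau k w|%:E)%E] <=
   P [set w | (delta%:E <= (\sum_(k < N) D k w ^+ 2 * h tau k)%:E)%E] +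
   (delta / eps ^+ 2)%:E)%E.
Proof.
move=> e0 d0.
pose Q n w := \sum_(k < n) D k w ^+ 2 * h tau k.
(* The test uses [Q k.+1], which includes the current term, so that the stopped bracket never
   overshoots [delta]. It is still known at time [tau k], since it involves only [D 0, ..., D k]. *)
pose D' k w := D k w * (Q k.+1 w <= delta)%R%:R.
have FD' k : (k < N)%N -> measurable_wrt (F (tau k)) (D' k).
  move=> kN.
  have sF : sigma_algebra setT (F (tau k)).
    by apply: (filtration_sigma_algebra F_filtration); exact: itv (ltnW kN).
  have FS i : (i < k.+1)%N -> measurable_wrt (F (tau k)) (D i).
    move=> ik; have /andP[i0 _] := itv (ltnW (leq_trans ik kN)).
    have /andP[_ kT] := itv (ltnW kN).
    apply: (measurable_wrtS F_filtration i0 _ kT).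
      by apply: (grid_le tau_grid) => //; exact: ltnW.
    by apply: FD; exact: leq_trans ik kN.
  have FQ n : (n <= k.+1)%N -> measurable_wrt (F (tau k)) (Q n).
    elim: n => [_|n IH nk].
      rewrite /Q (_ : (fun w => _) = (fun=> 0)); last first.
        by apply/funext => w; rewrite big_ord0.
      move=> B mB; rewrite preimage_cst; case: ifP => _.
        rewrite -setC0 -setTD; case: sF => F0 FC _; exact: FC.
      by case: sF.
    rewrite /Q (_ : (fun w => _) =
      (fun w => Q n w + D n w ^+ 2 * h tau n)); last first.
      by apply/funext => w; rewrite /Q big_ord_recr.
    apply: (@sub_measurable_fun2 _ _ _ _ (fun z => z.1 + z.2 ^+ 2 * h tau n)) => //.
    - apply: measurable_funD => //; apply: measurable_funM => //.
      exact: measurable_funX.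
    - by apply: IH; exact: ltnW.
    - exact: FS.
  apply: (@sub_measurable_fun2 _ _ _ _
    (fun z => z.1 * (z.2 <= delta)%R%:R) (D k) (Q k.+1) sF) => //.
  - apply: measurable_funM => //.
    rewrite (_ : (fun z => _) = (\1_(snd @^-1` `]-oo, delta]%classic) : R * R -> R)).
      apply: measurable_indic; rewrite -[X in measurable X]setTI.
      exact: measurable_snd.
    apply/funext => z; rewrite indicE; congr (_%:R); congr nat_of_bool.
    by apply/idP/idP; rewrite inE /= in_itv.
  - exact: FS.
  - exact: FQ.
have Qmono w m n : (m <= n)%N -> (n <= N)%N -> Q m w <= Q n w.
  elim: n => [|n IH]; first by rewrite leqn0 => /eqP ->.
  rewrite leq_eqVlt => /predU1P[-> //|mn nN].
  apply: (@le_trans _ _ (Q n w)); first by apply: IH => //; exact: ltnW.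
  by rewrite /Q big_ord_recr/= lerDl mulr_ge0 ?sqr_ge0 ?(grid_step_ge0 tau_grid).
(* The two bounds go through the induction together: while coefficients are kept, the bound by [Q]
   yields the bound by [delta]. *)
have Q'le w n : (n <= N)%N -> \sum_(k < n) D' k w ^+ 2 * h tau k <= Num.min delta (Q n w).
  elim: n => [_|n IH nN]; first by rewrite /Q !big_ord0 le_min ltW//= lexx.
  have hn := grid_step_ge0 tau_grid nN.
  rewrite big_ord_recr/= {2}/D'; have := IH (ltnW nN); rewrite !le_min => /andP[H1 H2].
  have H3 : \sum_(k < n) D' k w ^+ 2 * h tau k + (D n w) ^+ 2 * h tau n <= Q n.+1 w.
    by rewrite [leRHS]/Q big_ord_recr/= lerD2r.
  have H4 : Q n w <= Q n.+1 w by exact: Qmono.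
  have [Qd|Qd] := leP (Q n.+1 w) delta.
    by rewrite mulr1 H3 (le_trans H3 Qd).
  by rewrite mulr0 expr0n/= mul0r addr0 H1 (le_trans H2 H4).
have mM' : measurable_fun setT (fun w => \sum_(k < N) D' k w * dW tau k w).
  apply: measurable_sum => k; apply: measurable_funM.
    by apply: (measurable_wrt_fun F_filtration (itv (ltnW (ltn_ord k)))); exact: FD'.
  by apply: measurable_funB; apply: (wiener_measurable_fun F_filtration W_wiener);
    apply: itv => //; exact: ltnW.
have mM := measurable_ito_sum.
have mQ := measurable_ito_bracket (leqnn N).
have tail' : (P [set w | (eps%:E <= `|\sum_(k < N) D' k w * dW tau k w|%:E)%E] <=
    (delta / eps ^+ 2)%:E)%E.
  apply: chebyshev2 => //.
  rewrite (discrete_ito_isometry F_filtration W_wiener tau_grid FD').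
  apply: (@le_trans _ _ (\int[P]_w (cst delta%:E w))%E).
    apply: ge0_le_integral => //.
    - move=> w _; rewrite lee_fin sumr_ge0// => k _; rewrite mulr_ge0 ?sqr_ge0//.
      exact: (grid_step_ge0 tau_grid).
    - apply/measurable_EFinP; apply: measurable_sum => k.
      apply: measurable_funM => //; apply: measurable_funX.
      by apply: (measurable_wrt_fun F_filtration (itv (ltnW (ltn_ord k)))); exact: FD'.
    - move=> w _; rewrite lee_fin.
      by have := Q'le w N (leqnn N); rewrite le_min => /andP[].
  rewrite integral_cst// [X in (_ * X)%E](_ : _ = 1%E); last exact: probability_setT.
  by rewrite mule1.
apply: le_trans (leeD2l _ tail').
have m1 : measurable [set w | (delta%:E <= (Q N w)%:E)%E].
  by apply: measurable_superlevel; exact/measurable_EFinP.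
have m2 : measurable [set w | (eps%:E <= `|\sum_(k < N) D' k w * dW tau k w|%:E)%E].
  apply: measurable_superlevel; apply/measurable_EFinP.
  exact: measurableT_comp.
apply: le_trans (measureU2 _ m1 m2).
apply: le_measure; rewrite ?inE//.
- apply: measurable_superlevel; apply/measurable_EFinP.
  exact: measurableT_comp.
- exact: measurableU.
(* If the full bracket stays below [delta], then by monotonicity no coefficient was stopped and the
   two sums coincide. *)
- move=> w /= ew; have [?|] := leP delta%:E (Q N w)%:E; first by left.
  rewrite lte_fin => QN; right.
  rewrite (eq_bigr (fun k : 'I_N => D k w * dW tau k w))// => k _.
  rewrite /D' (_ : _ <= delta) ?mulr1//.
  by apply: le_trans (ltW QN); apply: Qmono.
Qed.

End one_grid.

Section grid_sequence.
Context (N : nat -> nat) (tau : nat -> nat -> R).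
Hypothesis tau_grid : forall n, grid T (N n) (tau n).

Lemma cvg0_ito_sum (D : nat -> nat -> Omega -> R) :
  (forall n k, (k < N n)%N -> measurable_wrt (F (tau n k)) (D n k)) ->
  cvg0_in_prob P (fun n w => (\sum_(k < N n) D n k w ^+ 2 * h (tau n) k)%:E) ->
  cvg0_in_prob P (fun n w => `|\sum_(k < N n) D n k w * dW (tau n) k w|%:E).
Proof.
move=> FD Q0 eps eps0.
apply/cvge0P => [n|x x0]; first exact: measure_ge0.
have x20 : 0 < x / 2 by rewrite divr_gt0.
(* This level makes the term [delta / eps ^+ 2] of [ito_sum_tail] equal to [x / 2]. *)
have d0 : 0 < x / 2 * eps ^+ 2 by rewrite mulr_gt0// exprn_gt0.
have /cvge0P-/(_ (fun=> measure_ge0 _ _)) /(_ _ x20) H := Q0 _ d0.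
near=> n.
apply: (le_trans (ito_sum_tail (tau_grid n) (FD n) eps0 d0)).
rewrite mulfK ?gt_eqF ?exprn_gt0//.
rewrite [x in (_ <= x%:E)%E]splitr EFinD leeD2r//.
by near: n.
Unshelve. all: by end_near. Qed.

Lemma cvg0_wiener_quadratic_variation :
  (forall n k, (k < N n)%N -> h (tau n) k <= T / n.+1%:R) ->
  cvg0_in_prob P
    (fun n w => `|\sum_(k < N n) dW (tau n) k w ^+ 2 - T|%:E).
Proof.
move=> mesh eps eps0.
apply/cvge0P => [n|x x0]; first exact: measure_ge0.
(* Chebyshev, with the variance bounded by [2 * (T / (n + 1))] times the sum of the steps, which is
   [T]. *)
have bound n : (P [set w |
    (eps%:E <= `|\sum_(k < N n) dW (tau n) k w ^+ 2 - T|%:E)%E] <=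
    (2 * T ^+ 2 / eps ^+ 2 * n.+1%:R^-1)%:E)%E.
  have itv i : (i <= N n)%N -> 0 <= tau n i <= T by exact: grid_itv.
  rewrite mulrAC; apply: chebyshev2 => //.
    apply: measurable_funB => //; apply: measurable_sum => k.
    apply: measurable_funX.
    by apply: measurable_funB; apply: (wiener_measurable_fun F_filtration W_wiener);
      apply: itv => //; exact: ltnW.
  rewrite (_ : (fun w => _) = (fun w =>
      ((\sum_(k < N n) (dW (tau n) k w ^+ 2 - h (tau n) k)) ^+ 2)%:E)); last first.
    by apply/funext => w; rewrite sumrB (grid_sum_steps (tau_grid n)).
  rewrite (wiener_quadratic_variation_variance F_filtration W_wiener (tau_grid n)).
  rewrite lee_fin -mulr_sumr -!mulrA ler_wpM2l//.
  apply: (@le_trans _ _ (\sum_(k < N n) h (tau n) k * (T / n.+1%:R))).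
    apply: ler_sum => k _; rewrite expr2 ler_wpM2l ?mesh//.
    exact: (grid_step_ge0 (tau_grid n)).
  by rewrite -mulr_suml (grid_sum_steps (tau_grid n)).
have : (2 * T ^+ 2 / eps ^+ 2 * n.+1%:R^-1) @[n --> \oo] --> (0 : R).
  rewrite -[X in _ --> X](mulr0 (2 * T ^+ 2 / eps ^+ 2)).
  by apply: cvgM; [exact: cvg_cst|exact: cvg_harmonic].
move=> /cvgr0Pnorm_le /(_ _ x0); apply: filterS => n Hn.
apply: (le_trans (bound n)); rewrite lee_fin.
exact: (le_trans (ler_norm _)).
Qed.

End grid_sequence.

End ito_sums_in_probability.

(** * Paths: primitives and Riemann sums *)

Section continuous_on_segment.
Context (R : realType) (T : R).
Implicit Types f g : R -> R.
Local Notation mu := (@lebesgue_measure R).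

Lemma segment_unif_continuous f : {within `[0, T], continuous f} ->
  forall e, 0 < e -> exists2 r, 0 < r & forall s t, 0 <= s <= T -> 0 <= t <= T ->
    `|s - t| < r -> `|f s - f t| < e.
Proof.
move=> /subspace_continuousP cf e e0.
(* Membership of [s] in the segment is part of [Q], because the covering property ranges over all
   real neighbours of a point, some outside [[0, T]]. *)
pose Q (r : R) (s : R) := forall t, 0 <= s <= T -> 0 <= t <= T ->
    `|s - t| < r -> `|f s - f t| < e.
have /compact_near_coveringP := @segment_compact R 0 T.
move=> /(_ R (at_right 0) Q _) H.
have : \forall r \near (0 : R)^'+, `[0, T]%classic `<=` Q r.
  apply: H => x xT.
  have /cvgrPdist_lt /(_ (e / 2)) := cf x xT.
  rewrite divr_gt0// => /(_ isT); rewrite near_withinE => /nbhs_ballP[r /= r0 Hr].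
  near=> s q => t s0T t0T sq.
  have sx : `|x - s| < r / 2.
    by near: s; apply: (@nbhsx_ballx _ _ x (r / 2)); rewrite divr_gt0.
  have qr : q < r / 2 by near: q; apply: nbhs_right_lt; rewrite divr_gt0.
  have fs : `|f x - f s| < e / 2.
    apply: Hr; rewrite ?in_itv//= -ball_normE/=.
    by rewrite (lt_trans sx)// ltr_pdivrMr// ltr_pMr// ltr1n.
  have ft : `|f x - f t| < e / 2.
    apply: Hr; rewrite ?in_itv//= -ball_normE/=.
    rewrite (_ : x - t = (x - s) + (s - t)); last by ring.
    rewrite (le_lt_trans (ler_normD _ _))// [ltRHS]splitr ltrD//.
    exact: lt_trans qr.
  rewrite (_ : f s - f t = (f x - f t) - (f x - f s)); last by ring.
  by rewrite (le_lt_trans (ler_normB _ _))// [ltRHS]splitr ltrD.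
rewrite near_withinE => /nbhs_ballP[r /= r0 Hr].
exists (r / 2); first by rewrite divr_gt0.
move=> s t s0T t0T st.
apply: (Hr (r / 2)) => //=.
- by rewrite -ball_normE/= sub0r normrN gtr0_norm ?divr_gt0// ltr_pdivrMr// ltr_pMr// ltr1n.
- by rewrite divr_gt0.
Unshelve. all: by end_near. Qed.

Lemma segment_bounded f : {within `[0, T], continuous f} ->
  exists2 C, 0 < C & forall t, 0 <= t <= T -> `|f t| <= C.
Proof.
move=> cf.
have /compact_bounded[M [_ HM]] := continuous_compact cf (@segment_compact R 0 T).
exists (`|M| + 1) => [|t t0T]; first by rewrite ltr_wpDl.
apply: (HM (`|M| + 1)); first by rewrite ltr_pwDr// ler_norm.
by exists t.
Qed.

Lemma segment_integrable f (s t : R) : {within `[0, T], continuous f} ->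
  0 <= s -> t <= T -> mu.-integrable `[s, t] (EFin \o f).
Proof.
move=> cf s0 tT; apply: continuous_compact_integrable.
  exact: segment_compact.
apply: continuous_subspaceW cf => x /=; rewrite !in_itv/= => /andP[sx xt].
by rewrite (le_trans s0 sx) (le_trans xt tT).
Qed.

Definition primitive f (t : R) : R := (\int[mu]_(s in `[0%R, t]) f s)%R.

Lemma primitive0 f : primitive f 0 = 0.
Proof. by rewrite /primitive set_itv1 Rintegral_set1. Qed.

Lemma primitiveB f s t : {within `[0, T], continuous f} ->
  0 <= s -> s <= t -> t <= T ->
  primitive f t - primitive f s = (\int[mu]_(u in `]s, t]) f u)%R.
Proof.
move=> cf s0 st tT; apply: Rintegral_itvB; rewrite ?bnd_simp//.
exact: segment_integrable.
Qed.

Lemma le_primitive_increment f g s t :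
  {within `[0, T], continuous f} -> {within `[0, T], continuous g} ->
  0 <= s -> s <= t -> t <= T -> (forall u, s <= u <= t -> f u <= g u) ->
  primitive f t - primitive f s <= primitive g t - primitive g s.
Proof.
move=> cf cg s0 st tT fg; rewrite !primitiveB//.
have Ioc k : {within `[0, T], continuous k} -> mu.-integrable `]s, t] (EFin \o k).
  move=> ck; apply: (@integrableS _ (measurableTypeR R) _ mu `[s, t]%classic).
  - exact: measurable_itv.
  - exact: measurable_itv.
  - exact: subset_itv_oc_cc.
  - exact: segment_integrable.
apply: le_Rintegral; [exact: measurable_itv|exact: Ioc|exact: Ioc|].
by move=> u /=; rewrite in_itv/= => /andP[/ltW su ut]; apply: fg; rewrite su.
Qed.

Lemma primitive_cst (K t : R) : 0 <= t -> primitive (cst K) t = K * t.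
Proof.
move=> t0; rewrite /primitive Rintegral_cst; last exact: measurable_itv.
congr (_ * _); rewrite [X in fine X](_ : _ = t%:E)//.
have := @lebesgue_measure_itv R (Interval (BLeft 0) (BRight t)).
rewrite /= lte_fin; case: ifPn => [_ -> |]; first by rewrite oppr0 addr0.
by rewrite -leNgt => t_le0 ->; rewrite (@le_anti _ _ t 0) ?t0 ?t_le0.
Qed.

Lemma primitive_increment_ge f s t K : {within `[0, T], continuous f} ->
  0 <= s -> s <= t -> t <= T -> (forall u, s <= u <= t -> K <= f u) ->
  K * (t - s) <= primitive f t - primitive f s.
Proof.
move=> cf s0 st tT Kf.
rewrite mulrBr -!primitive_cst ?(le_trans s0 st)//.
apply: le_primitive_increment => //.
by apply: continuous_subspaceT => x; exact: cvg_cst.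
Qed.

Lemma primitive_increment_le f s t K : {within `[0, T], continuous f} ->
  0 <= s -> s <= t -> t <= T -> (forall u, s <= u <= t -> f u <= K) ->
  primitive f t - primitive f s <= K * (t - s).
Proof.
move=> cf s0 st tT Kf.
rewrite mulrBr -!primitive_cst ?(le_trans s0 st)//.
apply: le_primitive_increment => //.
by apply: continuous_subspaceT => x; exact: cvg_cst.
Qed.

Lemma primitive_increment_norm_le f s t K : {within `[0, T], continuous f} ->
  0 <= s -> s <= t -> t <= T -> (forall u, s <= u <= t -> `|f u| <= K) ->
  `|primitive f t - primitive f s| <= K * (t - s).
Proof.
move=> cf s0 st tT fK; rewrite ler_norml -mulNr.
rewrite primitive_increment_ge ?primitive_increment_le// => u /fK.
  by rewrite ler_norml => /andP[].
by rewrite ler_norml => /andP[].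
Qed.

Lemma primitive_linear f g (c : R) t :
  {within `[0, T], continuous f} -> {within `[0, T], continuous g} ->
  t <= T ->
  primitive f t - c * primitive g t = primitive (fun s => f s - c * g s) t.
Proof.
move=> cf cg tT.
have mt : @measurable _ (measurableTypeR R) `[0, t]%classic.
  exact: measurable_itv.
have If := segment_integrable cf (lexx 0) tT.
have Ig := segment_integrable cg (lexx 0) tT.
rewrite /primitive -(RintegralZl c mt Ig).
rewrite -(RintegralB mt If)//.
exact: (integrableZl mt c Ig).
Qed.

End continuous_on_segment.

(** * Sums along a fine partition, for a fixed path *)

Section pathwise.
Context (R : realType) (T : R).
Implicit Types f g : R -> R.

Lemma within_continuousM (A : set R) f g :
  {within A, continuous f} -> {within A, continuous g} ->
  {within A, continuous (fun u => f u * g u)}.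
Proof. by move=> cf cg x; exact: (cvgM (cf x) (cg x)). Qed.

Lemma within_continuousB (A : set R) f g :
  {within A, continuous f} -> {within A, continuous g} ->
  {within A, continuous (fun u => f u - g u)}.
Proof. by move=> cf cg x; exact: (cvgB (cf x) (cg x)). Qed.

Lemma within_continuous_cst (A : set R) (c : R) : {within A, continuous (fun=> c)}.
Proof. by apply: continuous_subspaceT => x; exact: cvg_cst. Qed.

Lemma within_continuous_sqrB (A : set R) f (c : R) :
  {within A, continuous f} -> {within A, continuous (fun u => (c - f u) ^+ 2)}.
Proof.
move=> cf; have cB := within_continuousB (@within_continuous_cst A c) cf.
exact: (within_continuousM cB cB).
Qed.

Section grid_estimates.
Context (N : nat) (tau : nat -> R).
Hypothesis tau_grid : grid T N tau.

Local Notation h k := (tau k.+1 - tau k).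
Local Notation incr f k := (primitive f (tau k.+1) - primitive f (tau k)).

Lemma sum_primitive_increments f : \sum_(k < N) incr f k = primitive f T.
Proof.
have [t0 tT _] := tau_grid.
rewrite -(big_mkord xpredT (fun k => incr f k)) (telescope_sumr (fun k => primitive f (tau k)))//.
by rewrite t0 tT primitive0 subr0.
Qed.

Lemma grid_cell k u : (k < N)%N -> tau k <= u <= tau k.+1 ->
  [/\ 0 <= u <= T, 0 <= tau k <= T & `|tau k - u| <= h k].
Proof.
move=> kN /andP[ku uk].
have /andP[k0 kT] := grid_itv tau_grid (ltnW kN).
have /andP[k10 k1T] := grid_itv tau_grid kN.
split; first by rewrite (le_trans k0 ku) (le_trans uk k1T).
  by rewrite k0 kT.
by rewrite distrC ger0_norm ?subr_ge0// lerD2r.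
Qed.

Lemma grid_cell_bounds k : (k < N)%N ->
  [/\ 0 <= tau k, tau k <= tau k.+1 & tau k.+1 <= T].
Proof.
move=> kN; have /andP[k0 kT] := grid_itv tau_grid (ltnW kN).
have /andP[k10 k1T] := grid_itv tau_grid kN.
by split => //; rewrite -subr_ge0 (grid_step_ge0 tau_grid).
Qed.

Variables (eps eta : R).
Hypothesis mesh : forall k, (k < N)%N -> h k <= eta.

Definition modulus f := forall s t, 0 <= s <= T -> 0 <= t <= T ->
  `|s - t| <= eta -> `|f s - f t| <= eps.

Lemma modulus_cell f k u : modulus f -> (k < N)%N -> tau k <= u <= tau k.+1 ->
  `|f (tau k) - f u| <= eps.
Proof.
move=> mf kN ku; have [u0T k0T kul] := grid_cell kN ku.
by apply: mf => //; exact: le_trans kul (mesh kN).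
Qed.

Lemma riemann_sum_error f : {within `[0, T], continuous f} -> modulus f ->
  `|\sum_(k < N) f (tau k) * h k - primitive f T| <= eps * T.
Proof.
move=> cf mf; rewrite -(sum_primitive_increments f) -sumrB.
rewrite -(grid_sum_steps tau_grid) mulr_sumr.
apply: (le_trans (ler_norm_sum _ _ _)); apply: ler_sum => k _.
have [k0 kS kT] := grid_cell_bounds (ltn_ord k).
rewrite ler_norml; apply/andP; split.
- rewrite lerBrDl -lerBrDr opprK -mulrDl.
  apply: (primitive_increment_le cf) => // u /(modulus_cell mf (ltn_ord k)).
  by rewrite ler_norml => /andP[+ _]; lra.
- rewrite lerBlDr -lerBlDl -mulrBl.
  apply: (primitive_increment_ge cf) => // u /(modulus_cell mf (ltn_ord k)).
  by rewrite ler_norml => /andP[_ +]; lra.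
Qed.

Lemma sum_square_oscillation_le f : {within `[0, T], continuous f} -> modulus f ->
  \sum_(k < N) incr (fun u => (f (tau k) - f u) ^+ 2) k <= eps ^+ 2 * T.
Proof.
move=> cf mf; rewrite -(grid_sum_steps tau_grid) mulr_sumr.
apply: ler_sum => k _; have [k0 kS kT] := grid_cell_bounds (ltn_ord k).
apply: (@primitive_increment_le _ T) => //.
  exact: within_continuous_sqrB.
move=> u /(modulus_cell mf (ltn_ord k)) ku.
by rewrite -real_normK ?num_real// ler_pXn2r// nnegrE// (le_trans _ ku).
Qed.

(* Summation by parts for the square, with the increments of [y] split into a
   drift part and the increments of [x]. *)
Lemma ito_sum_error (y x beta : R -> R) (C : R) : 0 <= C ->
  {within `[0, T], continuous y} -> {within `[0, T], continuous beta} ->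
  (forall t, 0 <= t <= T -> y t = y 0 + primitive beta t + x t) ->
  (forall t, 0 <= t <= T -> `|beta t| <= C) ->
  modulus y ->
  `|\sum_(k < N) y (tau k) * (x (tau k.+1) - x (tau k)) -
    (2^-1 * (y T ^+ 2 - y 0 ^+ 2 - T) - primitive (fun s => y s * beta s) T) +
    2^-1 * (\sum_(k < N) (x (tau k.+1) - x (tau k)) ^+ 2 - T)|
  <= (2 * C * eps + C ^+ 2 * eta) * T.
Proof.
move=> C0 cy cb yE bC my.
have [t0 tT _] := tau_grid.
pose yb s := y s * beta s.
have cyb : {within `[0, T], continuous yb} by exact: within_continuousM.
have sq : y T ^+ 2 - y 0 ^+ 2 = \sum_(k < N) (y (tau k.+1) ^+ 2 - y (tau k) ^+ 2).
  rewrite -(big_mkord xpredT (fun k => y (tau k.+1) ^+ 2 - y (tau k) ^+ 2)).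
  by rewrite (telescope_sumr (fun k => y (tau k) ^+ 2))// t0 tT.
(* On a cell write [dy = A + dx] with [A] the drift increment. Then [dx^2 - dy^2 = A^2 - 2 A dy]
   eliminates [dx^2], and the two occurrences of [T] cancel. Each remaining term has order [eps * h]
   or [h^2], where [h] is the length of the cell. *)
rewrite (_ : _ + _ = \sum_(k < N) ((incr yb k - y (tau k) * incr beta k) -
    incr beta k * (y (tau k.+1) - y (tau k)) + 2^-1 * incr beta k ^+ 2)); last first.
  rewrite sq -(sum_primitive_increments yb).
  set S1 := \sum_(k < N) _ * _; set S2 := \sum_(k < N) (_ - _).
  set S3 := \sum_(k < N) incr _ _; set S4 := \sum_(k < N) _ ^+ 2.
  have -> : S1 - (2^-1 * (S2 - T) - S3) + 2^-1 * (S4 - T) =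
    S1 - 2^-1 * S2 + S3 + 2^-1 * S4 by field.
  rewrite /S1 /S2 /S3 /S4 !mulr_sumr -sumrB -!big_split/=.
  apply: eq_bigr => k _.
  have itv i : (i <= N)%N -> 0 <= tau i <= T by exact: grid_itv.
  rewrite (yE (tau k.+1)) ?itv// (yE (tau k)) ?itv ?(ltnW (ltn_ord k))//.
  by field.
rewrite -[X in _ * X](grid_sum_steps tau_grid) mulr_sumr.
apply: (le_trans (ler_norm_sum _ _ _)); apply: ler_sum => k _.
have kN := ltn_ord k.
have [k0 kS kT] := grid_cell_bounds kN.
have h0 : 0 <= h k by rewrite subr_ge0.
have A_le : `|incr beta k| <= C * h k.
  apply: (primitive_increment_norm_le cb) => // u /(grid_cell kN)[u0T _ _].
  exact: bC.
have dy_le : `|y (tau k.+1) - y (tau k)| <= eps.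
  by rewrite distrC; apply: (modulus_cell my kN); rewrite kS lexx.
have B_le : `|incr yb k - y (tau k) * incr beta k| <= eps * C * h k.
  have -> : incr yb k - y (tau k) * incr beta k =
      incr (fun s => yb s - y (tau k) * beta s) k.
    rewrite -!(primitive_linear (y (tau k)) cyb cb)//; first by ring.
    exact: le_trans kS kT.
  apply: (@primitive_increment_norm_le _ T) => //.
    apply: within_continuousB => //; apply: within_continuousM => //.
    exact: within_continuous_cst.
  move=> u ku; have [u0T _ _] := grid_cell kN ku.
  rewrite /yb -mulrBl normrM ler_pM// ?bC//.
  by rewrite distrC; exact: (modulus_cell my kN).
have eps0 : 0 <= eps by exact: le_trans dy_le.
apply: (@le_trans _ _ (eps * C * h k + C * h k * eps + C * h k * (C * h k))).
  apply: (le_trans (ler_normD _ _)); apply: lerD.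
    apply: (le_trans (ler_normB _ _)); apply: lerD => //.
    by rewrite normrM ler_pM.
  rewrite normrM (ger0_norm (x := 2^-1))// expr2 normrM.
  apply: (@le_trans _ _ (`|incr beta k| * `|incr beta k|)).
    by rewrite ler_piMl ?mulr_ge0// invf_le1// ler1n.
  by rewrite ler_pM.
have : C * h k * (C * h k) <= C ^+ 2 * eta * h k.
  rewrite (_ : C * h k * (C * h k) = C ^+ 2 * h k * h k); last by ring.
  by rewrite ler_wpM2r// ler_wpM2l ?sqr_ge0// mesh.
lra.
Qed.

End grid_estimates.

End pathwise.

(** * Partitions and simple processes *)

Section refinement.
Context (R : realType).
Implicit Types (tau : nat -> R).

(** Linear interpolation with [m] equal pieces per cell. Piece [k] lies in the old cell [k %/ m], so
    the coefficient of a simple process on it is found by integer division. *)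
Definition refine tau (m k : nat) : R :=
  tau (k %/ m)%N + (k %% m)%:R / m%:R * (tau (k %/ m).+1 - tau (k %/ m)%N).

(** Allowing [j = m], where the end of one block is the start of the next, lets one formula describe
    both ends of every piece. *)
Lemma refine_block tau m i j : (0 < m)%N -> (j <= m)%N ->
  refine tau m (i * m + j) = tau i + j%:R / m%:R * (tau i.+1 - tau i).
Proof.
move=> m0; rewrite leq_eqVlt => /predU1P[->|jm].
  rewrite -mulSnr /refine mulnK// modnMl mul0r mul0r addr0.
  by rewrite divff ?pnatr_eq0 -?lt0n// mul1r addrC subrK.
by rewrite /refine divnMDl// divn_small// addn0 modnMDl modn_small.
Qed.

Lemma refine_knot tau m i : (0 < m)%N -> refine tau m (i * m) = tau i.
Proof. by move=> m0; rewrite -[X in refine _ _ X]addn0 refine_block// mul0r mul0r addr0. Qed.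

Lemma refine_step tau m k : (0 < m)%N ->
  refine tau m k.+1 - refine tau m k = (tau (k %/ m).+1 - tau (k %/ m)%N) / m%:R.
Proof.
move=> m0; have km := ltn_pmod k m0.
have m0' : m%:R != 0 :> R by rewrite pnatr_eq0 -lt0n.
rewrite {1 2}(divn_eq k m) -addnS !refine_block//; last exact: ltnW.
by rewrite -natr1; field.
Qed.

Lemma refine_grid (T : R) N tau m : (0 < m)%N -> grid T N tau ->
  grid T (N * m) (refine tau m).
Proof.
move=> m0 [t0 tT tS]; split.
- by rewrite -[0%N](mul0n m) refine_knot.
- by rewrite refine_knot.
- move=> k kN; rewrite -subr_ge0 refine_step// divr_ge0// subr_ge0 tS//.
  by rewrite ltn_divLR.
Qed.

(** The mesh of [tau] is uncontrolled, but no cell is longer than [T]. *)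
Lemma refine_mesh (T : R) N tau m k : (0 < m)%N -> grid T N tau ->
  (k < N * m)%N -> refine tau m k.+1 - refine tau m k <= T / m%:R.
Proof.
move=> m0 gr kN; rewrite refine_step// ler_wpM2r ?invr_ge0//.
have kmN : (k %/ m < N)%N by rewrite ltn_divLR.
have /andP[k0 _] := grid_itv gr (ltnW kmN).
have /andP[_ kT] := grid_itv gr kmN.
by rewrite lerBlDr (le_trans kT)// lerDl.
Qed.

(** The sum telescopes within each block. [G] depends on the block because it will contain the
    coefficient of a simple process there. *)
Lemma sum_refine (G : nat -> R -> R) tau m N : (0 < m)%N ->
  \sum_(k < N * m)
     (G (k %/ m)%N (refine tau m k.+1) - G (k %/ m)%N (refine tau m k)) =
  \sum_(i < N) (G i (tau i.+1) - G i (tau i)).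
Proof.
move=> m0; elim: N => [|N IH]; first by rewrite mul0n !big_ord0.
rewrite mulSnr big_split_ord/= IH big_ord_recr/=; congr (_ + _).
rewrite (eq_bigr (fun j : 'I_m => G N (refine tau m (N * m + j).+1) -
    G N (refine tau m (N * m + j)))); last first.
  by move=> j _; rewrite divnMDl// divn_small// addn0.
rewrite -(big_mkord xpredT (fun j => G N (refine tau m (N * m + j).+1) -
    G N (refine tau m (N * m + j)))).
under eq_bigr do rewrite -addnS.
rewrite (telescope_sumr (fun j => G N (refine tau m (N * m + j))))//.
by rewrite addn0 -mulSnr !refine_knot.
Qed.

End refinement.

Section paths.
Context (R : realType).

Lemma modulus_near (T : R) (f : R -> R) (eps : R) : 0 <= T ->
  {within `[0, T], continuous f} -> 0 < eps ->
  \forall n \near \oo, modulus T eps (T / n.+1%:R) f.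
Proof.
move=> T0 cf e0; have [r r0 Hr] := segment_unif_continuous cf e0.
have : T / n.+1%:R @[n --> \oo] --> (0 : R).
  by rewrite -[X in _ --> X](mulr0 T); apply: cvgM; [exact: cvg_cst|exact: cvg_harmonic].
move=> /cvgr_lt /(_ _ r0); apply: filterS => n nr s t s0T t0T st.
by apply/ltW/Hr => //; exact: le_lt_trans nr.
Qed.

Definition trivial_grid (T : R) (k : nat) : R := if k is 0%N then 0 else T.

Lemma trivial_gridP (T : R) : 0 <= T -> grid T 1 (trivial_grid T).
Proof. by move=> T0; split=> // -[]. Qed.

Definition uniform_grid (T : R) (n : nat) : nat -> R := refine (trivial_grid T) n.+1.

Lemma uniform_gridP (T : R) n : 0 <= T -> grid T n.+1 (uniform_grid T n).
Proof. by move=> T0; rewrite -[X in grid _ X]mul1n; apply: refine_grid => //; exact: trivial_gridP. Qed.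

Lemma uniform_grid_mesh (T : R) n k : 0 <= T -> (k < n.+1)%N ->
  uniform_grid T n k.+1 - uniform_grid T n k <= T / n.+1%:R.
Proof.
by move=> T0 kn; apply: (refine_mesh _ (trivial_gridP T0)) => //; rewrite mul1n.
Qed.

(** Continuity of the paths makes the integral a pointwise limit of Riemann sums, each a finite
    combination of the measurable [X s]. *)
Lemma measurable_primitive d (Omega : measurableType d) (T : R)
    (X : R -> Omega -> R) (t : R) :
  (forall s, 0 <= s <= T -> measurable_fun setT (X s)) ->
  continuous_paths T X -> 0 <= t <= T ->
  measurable_fun setT (fun w => primitive (fun s => X s w) t).
Proof.
move=> mX cX /andP[t0 tT].
pose S n w := \sum_(k < n.+1) X (uniform_grid t n k) w *
   (uniform_grid t n k.+1 - uniform_grid t n k).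
have mS n : measurable_fun setT (S n).
  apply: measurable_sum => k; apply: measurable_funM => //.
  have /andP[k0 kt] := grid_itv (uniform_gridP n t0) (ltnW (ltn_ord k)).
  by apply: mX; rewrite k0 (le_trans kt tT).
apply: (measurable_fun_cvg (h := S)) => // w _.
have cf : {within `[0, t], continuous (fun s => X s w)}.
  apply: continuous_subspaceW (cX w); apply: subset_itvl.
  by rewrite bnd_simp.
apply/cvgrPdist_le => e e0.
(* The denominator [1 + t] rather than [t] covers [t = 0]. *)
have e1 : 0 < e / (1 + t) by rewrite divr_gt0// ltr_pwDl.
have := modulus_near t0 cf e1; apply: filterS => n mod_n.
rewrite distrC.
apply: (le_trans (riemann_sum_error (uniform_gridP n t0) _ cf mod_n)).
  by move=> k kn; exact: uniform_grid_mesh.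
rewrite mulrAC ler_pdivrMr ?ltr_pwDl// ler_wpM2l ?(ltW e0)//.
by rewrite lerDr.
Qed.

End paths.

Section simple_processes.
Context (R : realType) (d : measure_display) (Omega : measurableType d).
Variables (T : R) (F : R -> set (set Omega)).
Local Notation mu := (@lebesgue_measure R).

Lemma simple_process_grid (S : simple_process R Omega) :
  simple_process_on F T S -> grid T (simple_size S) (simple_time S).
Proof. by case. Qed.

Lemma simple_valueE (S : simple_process R Omega) i u w :
  simple_process_on F T S -> (i < simple_size S)%N ->
  simple_time S i < u <= simple_time S i.+1 ->
  simple_value S u w = simple_coef S i w.
Proof.
move=> /simple_process_grid gr iN /andP[iu ui].
rewrite /simple_value (bigD1 (Ordinal iN))//= indicE mem_set/=; last first.
  by rewrite in_itv/= iu ui.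
rewrite mulr1 big1 ?addr0// => j ji.
rewrite indicE memNset ?mulr0//= in_itv/= => /andP[ju uj].
move: ji; rewrite -val_eqE/= neq_ltn => /orP[lt_ji|lt_ij].
  have := grid_le gr lt_ji (ltnW iN).
  by rewrite leNgt (lt_le_trans iu uj).
have := grid_le gr lt_ij (ltnW (ltn_ord j)).
by rewrite leNgt (lt_le_trans ju ui).
Qed.

Lemma integral_simple_process_sqr (S : simple_process R Omega) (y : R -> R) w :
  simple_process_on F T S -> {within `[0, T], continuous y} ->
  (\int[mu]_(s in `[0%R, T]) ((simple_value S s w - y s) ^+ 2)%:E =
   (\sum_(i < simple_size S)
      (primitive (fun s => (simple_coef S i w - y s) ^+ 2) (simple_time S i.+1) -
       primitive (fun s => (simple_coef S i w - y s) ^+ 2) (simple_time S i)))%:E)%E.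
Proof.
move=> SF cy; have gr := simple_process_grid SF.
have [t0 tT tS] := gr.
set N := simple_size S in gr tT tS *.
pose g s := ((simple_value S s w - y s) ^+ 2)%:E.
have mg t : t <= T -> measurable_fun `]0, t] g.
  move=> tleT; apply/measurable_EFinP; apply: measurable_funX.
  apply: measurable_funB.
    apply: measurable_sum => i; exact: measurable_funM.
  apply: subspace_continuous_measurable_fun; first exact: measurable_itv.
  apply: continuous_subspaceW cy => u /=; rewrite !in_itv/= => /andP[/ltW -> ut].
  exact: le_trans ut tleT.
have g0 s : (0 <= g s)%E by rewrite lee_fin sqr_ge0.
(* Cells are open on the left and the simple process vanishes at 0; dropping this null point leaves
   a disjoint union of cells. *)
rewrite -integral_itv_obnd_cbnd; last exact: mg.
suff : forall n, (n <= N)%N -> (\int[mu]_(s in `]0%R, simple_time S n]) g s =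
   (\sum_(i < n)
      (primitive (fun s => (simple_coef S i w - y s) ^+ 2) (simple_time S i.+1) -
       primitive (fun s => (simple_coef S i w - y s) ^+ 2) (simple_time S i)))%:E)%E.
  by move=> /(_ N (leqnn N)); rewrite tT.
elim=> [_|n IH nN].
  by rewrite t0 big_ord0 set_itvoc0 integral_set0.
have [n0 nS nT] := grid_cell_bounds gr nN.
rewrite big_ord_recr/= EFinD -IH ?(ltnW nN)//.
have EU : `]0, simple_time S n.+1]%classic =
    `]0, simple_time S n] `|` `]simple_time S n, simple_time S n.+1].
  by apply: itv_bndbnd_setU; rewrite bnd_simp.
rewrite EU ge0_integral_setU//=; last 2 first.
- by rewrite -EU; exact: mg.
- apply/disj_setPLR => u /=; rewrite !in_itv/= => /andP[_ un] /=.
  by apply/negP; rewrite (leNgt u) in un; rewrite negb_and un.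
congr (_ + _)%E.
rewrite (primitiveB (T := T))//; last exact: within_continuous_sqrB.
have cn := @within_continuous_sqrB R `[0, T]%classic y (simple_coef S n w) cy.
have In : mu.-integrable `]simple_time S n, simple_time S n.+1]
    (fun s => ((simple_coef S n w - y s) ^+ 2)%:E).
  apply: (@integrableS _ (measurableTypeR R) _ mu
    `[simple_time S n, simple_time S n.+1]%classic).
  - exact: measurable_itv.
  - exact: measurable_itv.
  - exact: subset_itv_oc_cc.
  - exact: (segment_integrable cn).
rewrite /Rintegral fineK; last first.
  by apply: integrable_fin_num => //; exact: measurable_itv.
apply: eq_integral => u; rewrite inE/= in_itv/= => nu.
by rewrite /g (simple_valueE w SF nN).
Qed.

End simple_processes.

(** * The stochastic integral of the solution against itself *)

Section ornstein_uhlenbeck.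
Context (R : realType) (d : measure_display) (Omega : measurableType d)
  (P : probability Omega R) (T mu a y0 : R) (F : R -> set (set Omega))
  (W Y : R -> Omega -> R).
Hypothesis T_gt0 : 0 < T.
Hypothesis F_filtration : filtration F T.
Hypothesis W_wiener : wiener_process P F T W.
Hypothesis Y_solution : ou_solution P F T W mu a y0 Y.

Let T_ge0 : 0 <= T. Proof. exact: ltW. Qed.
Let beta := ou_drift mu a Y.

Local Notation incr f tau k := (primitive f (tau k.+1) - primitive f (tau k)).

Lemma ou_measurable t : 0 <= t <= T -> measurable_fun setT (Y t).
Proof. by apply: (adapted_measurable_fun F_filtration); case: Y_solution. Qed.

Lemma ou_continuous : continuous_paths T Y.
Proof. by case: Y_solution. Qed.

Lemma ou_drift_continuous : continuous_paths T beta.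
Proof.
move=> w; apply: within_continuousB; first exact: within_continuous_cst.
by apply: within_continuousM; [exact: within_continuous_cst|exact: ou_continuous].
Qed.

(* [Y^2] has the drift [2 Y beta + 1] and the diffusion coefficient [2 Y]. *)
Definition ou_square_integral (w : Omega) : R :=
  2^-1 * (Y T w ^+ 2 - Y 0 w ^+ 2 - T) -
  primitive (fun s => Y s w * beta s w) T.

Lemma ou_square_integral_measurable : measurable_fun setT ou_square_integral.
Proof.
have T0 : 0 <= T <= T by rewrite T_ge0 lexx.
have T00 : 0 <= (0 : R) <= T by rewrite T_ge0 lexx.
apply: measurable_funB.
  apply: measurable_funM => //; apply: measurable_funB => //.
  by apply: measurable_funB; apply: measurable_funX; exact: ou_measurable.
apply: (@measurable_primitive _ _ _ T (fun s w => Y s w * beta s w)) => //.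
- move=> s s0T; apply: measurable_funM; first exact: ou_measurable.
  apply: measurable_funB => //; apply: measurable_funM => //; exact: ou_measurable.
- by move=> w; apply: within_continuousM;
    [exact: ou_continuous|exact: ou_drift_continuous].
Qed.

Section grids.
Context (N : nat -> nat) (tau : nat -> nat -> R).
Hypothesis tau_grid : forall n, grid T (N n) (tau n).
Hypothesis mesh :
  forall n k, (k < N n)%N -> tau n k.+1 - tau n k <= T / n.+1%:R.

Local Notation dW n k w := (W (tau n k.+1) w - W (tau n k) w).
Local Notation h n k := (tau n k.+1 - tau n k).

Let left_point_sum n w := \sum_(k < N n) Y (tau n k) w * dW n k w.

Let tau_itv n k : (k <= N n)%N -> 0 <= tau n k <= T.
Proof. exact: grid_itv. Qed.

Lemma measurable_left_point_sum n : measurable_fun setT (left_point_sum n).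
Proof.
apply: measurable_sum => k; apply: measurable_funM.
  by apply: ou_measurable; apply: tau_itv; exact: ltnW.
by apply: measurable_funB; apply: (wiener_measurable_fun F_filtration W_wiener);
  apply: tau_itv => //; exact: ltnW.
Qed.

Lemma cvg0_left_point_sum :
  cvg0_in_prob P (fun n w => `|left_point_sum n w - ou_square_integral w|%:E).
Proof.
pose QV n w := \sum_(k < N n) dW n k w ^+ 2 - T.
(* With half the quadratic variation error added, the remainder vanishes path by path, by
   [ito_sum_error]; the quadratic variation error itself is treated in probability. *)
pose Z n w := left_point_sum n w - ou_square_integral w + 2^-1 * QV n w.
have mI := ou_square_integral_measurable.
have mS := measurable_left_point_sum.
have mQV n : measurable_fun setT (QV n).
  apply: measurable_funB => //; apply: measurable_sum => k; apply: measurable_funX.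
  by apply: measurable_funB; apply: (wiener_measurable_fun F_filtration W_wiener);
    apply: tau_itv => //; exact: ltnW.
have mZ n : measurable_fun setT (Z n).
  by apply: measurable_funD; [exact: measurable_funB|exact: measurable_funM].
have mnorm (f : Omega -> R) : measurable_fun setT f ->
    measurable_fun setT (fun w => `|f w|%:E).
  by move=> mf; apply/measurable_EFinP; exact: measurableT_comp.
have Z0 : cvg0_in_prob P (fun n w => `|Z n w|%:E).
  apply: cvg0_in_prob_ae => [n|]; first exact: mnorm.
  have [_ _ _] := Y_solution.
  apply: filterS => w YE e e0.
  have cY := @ou_continuous w; have cb := @ou_drift_continuous w.
  have [C C0 bC] := segment_bounded cb.
  have Y0E : Y 0 w = y0 by have [_ _ ->] := Y_solution.
  have YE' t : 0 <= t <= T ->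
      Y t w = Y 0 w + primitive (fun s => beta s w) t + W t w.
    by move=> t0T; rewrite Y0E; exact: YE.
  (* The error bound is [K * eps + C^2 * (T / (n + 1)) * T]. The choice [eps = e / 2 / (1 + K)]
     keeps the first term at most [e / 2], and large [n] makes the second one smaller than
     [e / 2]. *)
  pose K := 2 * C * T.
  have K0 : 0 < 1 + K by rewrite ltr_pwDl// !mulr_ge0// ltW.
  have e1 : 0 < e / 2 / (1 + K) by rewrite !divr_gt0.
  have E2 : C ^+ 2 * (T / n.+1%:R) * T @[n --> \oo] --> (0 : R).
    rewrite (_ : (fun n => _) = (fun n => C ^+ 2 * T * T * n.+1%:R^-1)); last first.
      by apply/funext => n; rewrite mulrA mulrAC.
    rewrite -[X in _ --> X](mulr0 (C ^+ 2 * T * T)).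
    by apply: cvgM; [exact: cvg_cst|exact: cvg_harmonic].
  have e20 : 0 < e / 2 by rewrite divr_gt0.
  have H1 := modulus_near T_ge0 cY e1.
  have H2 := cvgr_lt _ E2 _ e20.
  near=> n.
  have mod_n : modulus T (e / 2 / (1 + K)) (T / n.+1%:R) (fun s => Y s w).
    by near: n; exact: H1.
  have small : C ^+ 2 * (T / n.+1%:R) * T < e / 2 by near: n; exact: H2.
  rewrite lte_fin.
  have := @ito_sum_error _ T _ _ (tau_grid n) _ _ (@mesh n) (fun s => Y s w)
    (fun s => W s w) (fun s => beta s w) C (ltW C0) cY cb YE' bC mod_n.
  move=> /le_lt_trans; apply.
  rewrite mulrDl [e in ltRHS]splitr ler_ltD//.
  rewrite (_ : _ * T = (e / 2) * (K / (1 + K))); last by rewrite /K; ring.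
  by rewrite ler_piMr ?(ltW e20)// ler_pdivrMr// mul1r lerDr.
have QV0 : cvg0_in_prob P (fun n w => `|QV n w|%:E).
  exact: (cvg0_wiener_quadratic_variation F_filtration W_wiener tau_grid mesh).
have QV20 := @cvg0_in_probMl _ _ _ P 2^-1 _ _ (fun n => mnorm _ (mQV n)) _ QV0.
apply: (cvg0_in_prob_le _ _ _ (cvg0_in_probD _ _ Z0 (QV20 _ _))) => //.
- by move=> n; apply: mnorm; exact: measurable_funB.
- move=> n; apply: emeasurable_funD; first exact: mnorm.
  by apply: emeasurable_funM => //; exact: mnorm.
- move=> n; apply: aeW => w; rewrite -EFinM -EFinD lee_fin.
  rewrite (_ : left_point_sum n w - _ = Z n w - 2^-1 * QV n w); last first.
    by rewrite /Z addrK.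
  apply: (le_trans (ler_normB _ _)).
  by rewrite lerD2l normrM (ger0_norm (x := 2^-1)).
- by move=> n; exact: mnorm.
- by move=> n; apply: emeasurable_funM => //; exact: mnorm.
Unshelve. all: by end_near. Qed.

Let osc n w := \sum_(k < N n) incr (fun s => (Y (tau n k) w - Y s w) ^+ 2) (tau n) k.

Lemma measurable_incr_sqr (D : Omega -> R) s t : measurable_fun setT D ->
  0 <= s <= T -> 0 <= t <= T ->
  measurable_fun setT (fun w =>
    primitive (fun u => (D w - Y u w) ^+ 2) t -
    primitive (fun u => (D w - Y u w) ^+ 2) s).
Proof.
move=> mD s0T t0T.
suff mp r : 0 <= r <= T ->
    measurable_fun setT (fun w => primitive (fun u => (D w - Y u w) ^+ 2) r).
  by apply: measurable_funB; exact: mp.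
move=> r0T; apply: (@measurable_primitive _ _ _ T (fun u w => (D w - Y u w) ^+ 2)) => //.
- move=> u u0T; apply: measurable_funX; apply: measurable_funB => //.
  exact: ou_measurable.
- by move=> w; apply: within_continuous_sqrB; exact: ou_continuous.
Qed.

Lemma measurable_oscillation n : measurable_fun setT (osc n).
Proof.
apply: measurable_sum => k; apply: measurable_incr_sqr.
- by apply: ou_measurable; apply: tau_itv; exact: ltnW.
- by apply: tau_itv; exact: ltnW.
- exact: tau_itv.
Qed.

Lemma cvg0_oscillation : cvg0_in_prob P (fun n w => (osc n w)%:E).
Proof.
apply: cvg0_in_prob_ae => [n|].
  by apply/measurable_EFinP; exact: measurable_oscillation.
apply: aeW => w e e0.
(* The oscillation sum is at most [eps^2 * T], and this [eps] brings it below [e]. *)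
have e1 : 0 < Num.sqrt (e / (1 + T)) by rewrite sqrtr_gt0 divr_gt0// ltr_pwDl.
have := modulus_near T_ge0 (@ou_continuous w) e1; apply: filterS => n mod_n.
rewrite lte_fin.
apply: (le_lt_trans (sum_square_oscillation_le (tau_grid n) (@mesh n)
  (@ou_continuous w) mod_n)).
rewrite sqr_sqrtr; last by rewrite divr_ge0 ?ltW// ltr_pwDl.
by rewrite mulrAC ltr_pdivrMr ?ltr_pwDl// ltr_pM2l// ltrDr.
Qed.

End grids.

Let Y_adapted : adapted F T Y. Proof. by case: Y_solution. Qed.

Lemma ou_square_integral_is_ito : is_ito_integral P F T W Y ou_square_integral.
Proof.
split; first exact: ou_square_integral_measurable.
have gr n : grid T n.+1 (uniform_grid T n) by exact: uniform_gridP.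
have mesh n k : (k < n.+1)%N ->
    uniform_grid T n k.+1 - uniform_grid T n k <= T / n.+1%:R.
  exact: uniform_grid_mesh.
pose S n := SimpleProcess n.+1 (uniform_grid T n) (fun k => Y (uniform_grid T n k)).
have SF n : simple_process_on F T (S n).
  have [t0 tT tS] := gr n; split => // k kn; apply: Y_adapted.
  exact: (grid_itv (gr n) (ltnW kn)).
exists S; split => //; last exact: (cvg0_left_point_sum gr mesh).
rewrite (_ : (fun n w => _) = (fun n w =>
  (\sum_(k < n.+1) incr (fun s => (Y (uniform_grid T n k) w - Y s w) ^+ 2)
     (uniform_grid T n) k)%:E)).
  exact: (cvg0_oscillation gr mesh).
apply/funext => n; apply/funext => w.
exact: (integral_simple_process_sqr w (SF n) (@ou_continuous w)).
Qed.

(* Both simple processes are written on the partition of the given one refined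
   to mesh [T / n.+1]; there their difference has a bracket that tends to 0. *)
Lemma ou_ito_integral_unique (J : Omega -> R) :
  is_ito_integral P F T W Y J -> {ae P, forall w, J w = ou_square_integral w}.
Proof.
move=> [mJ [S [SF S_Y S_J]]].
pose N n := (simple_size (S n) * n.+1)%N.
pose tau n := refine (simple_time (S n)) n.+1.
have gS n : grid T (simple_size (S n)) (simple_time (S n)).
  exact: simple_process_grid.
have gr n : grid T (N n) (tau n) by exact: refine_grid.
have mesh n k : (k < N n)%N -> tau n k.+1 - tau n k <= T / n.+1%:R.
  exact: refine_mesh.
have divN n k : (k < N n)%N -> (k %/ n.+1 < simple_size (S n))%N.
  by move=> kN; rewrite ltn_divLR.
pose c n k := simple_coef (S n) (k %/ n.+1)%N.
pose D n k w := c n k w - Y (tau n k) w.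
have Fc n k : (k < N n)%N -> measurable_wrt (F (tau n k)) (c n k).
  move=> kN; have [_ _ _ /(_ _ (divN _ _ kN)) Fc] := SF n.
  have /andP[s0 _] := grid_itv (gS n) (ltnW (divN _ _ kN)).
  have /andP[_ kT] := grid_itv (gr n) (ltnW kN).
  apply: (measurable_wrtS F_filtration s0 _ kT Fc).
  rewrite -[leLHS](refine_knot (simple_time (S n)) (k %/ n.+1) (ltn0Sn n)).
  by apply: (grid_le (gr n)); [exact: leq_divM|exact: ltnW].
have FD n k : (k < N n)%N -> measurable_wrt (F (tau n k)) (D n k).
  move=> kN; have kT := grid_itv (gr n) (ltnW kN).
  apply: (@sub_measurable_fun2 _ _ _ _ (fun z => z.1 - z.2)) => //.
  - exact: (filtration_sigma_algebra F_filtration).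
  - exact: measurable_funB.
  - exact: Fc.
  - exact: Y_adapted.
have mc n k : (k < N n)%N -> measurable_fun setT (c n k).
  move=> kN; apply: (measurable_wrt_fun F_filtration (grid_itv (gr n) (ltnW kN))).
  exact: Fc.
pose B n w := \sum_(k < N n) D n k w ^+ 2 * (tau n k.+1 - tau n k).
pose E n w := \sum_(i < simple_size (S n))
  incr (fun s => (simple_coef (S n) i w - Y s w) ^+ 2) (simple_time (S n)) i.
pose osc n w := \sum_(k < N n)
  incr (fun s => (Y (tau n k) w - Y s w) ^+ 2) (tau n) k.
have E0 : cvg0_in_prob P (fun n w => (E n w)%:E).
  rewrite (_ : (fun n w => _) = (fun n w => \int[@lebesgue_measure R]_(s in `[0%R, T])
    ((simple_value (S n) s w - Y s w) ^+ 2)%R%:E)%E)//.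
  apply/funext => n; apply/funext => w.
  exact/esym/(integral_simple_process_sqr w (SF n) (@ou_continuous w)).
have EE n w : E n w = \sum_(k < N n)
    incr (fun s => (c n k w - Y s w) ^+ 2) (tau n) k.
  exact/esym/(sum_refine (fun i => primitive
    (fun s => (simple_coef (S n) i w - Y s w) ^+ 2))).
have mE n : measurable_fun setT (E n).
  rewrite (funext (EE n)); apply: measurable_sum => k.
  apply: measurable_incr_sqr; first exact: mc.
    by apply: (grid_itv (gr n)); exact: ltnW.
  exact: (grid_itv (gr n)).
have mosc n : measurable_fun setT (osc n) by exact: measurable_oscillation.
have mB n : measurable_fun setT (B n).
  exact: (measurable_ito_bracket F_filtration (gr n) (FD n)).
(* [B] is the integral of the squared distance between two step functions. On each cell both are
   compared with [Y s] through [(x - y)^2 <= 2 ((x - z)^2 + (y - z)^2)], integrated in [s]. *)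
have B_le n w : B n w <= 2 * (E n w + osc n w).
  rewrite EE /osc -big_split/= mulr_sumr; apply: ler_sum => k _.
  have [k0 kS kT] := grid_cell_bounds (gr n) (ltn_ord k).
  have cY := @ou_continuous w.
  have cc := within_continuous_sqrB (c := c n k w) cY.
  have ct := within_continuous_sqrB (c := Y (tau n k) w) cY.
  have sumE t : t <= T ->
      primitive (fun s => (c n k w - Y s w) ^+ 2) t +
      primitive (fun s => (Y (tau n k) w - Y s w) ^+ 2) t =
      primitive (fun s => (c n k w - Y s w) ^+ 2 -
        -1 * (Y (tau n k) w - Y s w) ^+ 2) t.
    by move=> tT; rewrite -(primitive_linear (-1) cc ct tT) mulN1r opprK.
  rewrite [X in _ <= 2 * X](_ : _ = incr (fun s => (c n k w - Y s w) ^+ 2 -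
      -1 * (Y (tau n k) w - Y s w) ^+ 2) (tau n) k); last first.
    by rewrite -!sumE ?(le_trans kS kT)//; ring.
  rewrite -ler_pdivrMl// mulrA.
  apply: (@primitive_increment_ge _ T) => //.
    apply: within_continuousB => //; apply: within_continuousM => //.
    exact: within_continuous_cst.
  move=> u _; rewrite /D; set x := c n k w; set y := Y (tau n k) w; set z := Y u w.
  have := sqr_ge0 ((x - z) + (y - z)); lra.
have B0 : cvg0_in_prob P (fun n w => (B n w)%:E).
  apply: (@cvg0_in_prob_le _ _ _ P _ (fun n w => 2%:E * ((E n w)%:E + (osc n w)%:E))%E).
  - by move=> n; exact/measurable_EFinP.
  - move=> n; apply: emeasurable_funM => //.
    by apply: emeasurable_funD; exact/measurable_EFinP.
  - by move=> n; apply: aeW => w; rewrite -EFinD -EFinM lee_fin.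
  - apply: cvg0_in_probMl => //.
    + by move=> n; apply: emeasurable_funD; exact/measurable_EFinP.
    + move=> n w; rewrite -EFinD lee_fin.
      have := B_le n w; have : 0 <= B n w; last by lra.
      rewrite sumr_ge0// => k _; rewrite mulr_ge0 ?sqr_ge0//.
      exact: (grid_step_ge0 (gr n)).
    + apply: cvg0_in_probD => //; [by move=> n; exact/measurable_EFinP..|].
      exact: (cvg0_oscillation gr mesh).
have M0 := cvg0_ito_sum F_filtration W_wiener gr FD B0.
have L0 := cvg0_left_point_sum gr mesh.
have mI := ou_square_integral_measurable.
have mL n := measurable_left_point_sum gr n.
have mM n := measurable_ito_sum F_filtration W_wiener (gr n) (FD n).
(* Refinement does not change the simple integral, which splits into an Ito sum of small bracket and
   the left-point sum of [Y]. *)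
have SE n w : simple_integral (S n) W w =
    \sum_(k < N n) D n k w * (W (tau n k.+1) w - W (tau n k) w) +
    \sum_(k < N n) Y (tau n k) w * (W (tau n k.+1) w - W (tau n k) w).
  rewrite -big_split/=; transitivity (\sum_(i < simple_size (S n))
      (simple_coef (S n) i w * W (simple_time (S n) i.+1) w -
       simple_coef (S n) i w * W (simple_time (S n) i) w)).
    by apply: eq_bigr => i _; rewrite mulrBr.
  have /= <- := sum_refine (fun i t => simple_coef (S n) i w * W t w)
    (simple_time (S n)) (simple_size (S n)) (ltn0Sn n).
  by apply: eq_bigr => k _; rewrite /D /c /tau; ring.
have mSI n : measurable_fun setT (simple_integral (S n) W).
  by rewrite (funext (SE n)); exact: measurable_funD.
have mnorm (f : Omega -> R) : measurable_fun setT f ->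
    measurable_fun setT (fun w => `|f w|%:E).
  by move=> mf; apply/measurable_EFinP; exact: measurableT_comp.
apply: (cvg0_in_prob_unique mJ mI _ _ _ S_J
  (cvg0_in_probD (fun n => mnorm _ (mM n))
    (fun n => mnorm _ (measurable_funB (mL n) mI)) M0 L0)).
- by move=> n; apply: mnorm; exact: measurable_funB.
- by move=> n; apply: emeasurable_funD; apply: mnorm => //; exact: measurable_funB.
- move=> n w; rewrite -!EFinD lee_fin SE.
  set x := \sum_(_ < _) _; set y := \sum_(_ < _) _.
  rewrite (_ : J w - _ = - (x + y - J w) + (x + (y - ou_square_integral w))).
    rewrite (le_trans (ler_normD _ _))// normrN lerD2l.
    exact: ler_normD.
  by ring.
Qed.

(** Existence of a version excludes the default of [ito_integral], and uniqueness evaluates it. The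
    drift integral then cancels, and [mu] and [a] with it. *)
Lemma ou_stochastic_integral :
  {ae P, forall w, ito_process_integral P F T W beta Y w =
    2^-1 * (Y T w ^+ 2 - Y 0 w ^+ 2 - T)}.
Proof.
have : is_ito_integral P F T W Y (ito_integral P F T W Y).
  exact: (@xgetPex _ (fun=> 0) _ (ex_intro _ _ ou_square_integral_is_ito)).
move=> /ou_ito_integral_unique; apply: filterS => w Iw.
rewrite /ito_process_integral Iw /ou_square_integral /primitive; ring.
Qed.

End ornstein_uhlenbeck.

(** * The maximizer *)

Section maximizer.
Context (R : realType) (T : R) (y : R -> R).
Hypothesis T_gt0 : 0 < T.
Hypothesis cy : {within `[0, T], continuous y}.

Let I1 := primitive y T.
Let I2 := primitive (fun t => y t ^+ 2) T.

Let cy2 : {within `[0, T], continuous (fun t => y t ^+ 2)}.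
Proof. exact: (within_continuousM cy cy). Qed.

Lemma primitive_sqr_affine (m b : R) :
  primitive (fun s => (m - b * y s) ^+ 2) T =
  m ^+ 2 * T - 2 * m * b * I1 + b ^+ 2 * I2.
Proof.
have c1 := @within_continuous_cst R `[0, T]%classic (m ^+ 2).
have c2 := within_continuousB c1
  (within_continuousM (@within_continuous_cst R `[0, T]%classic (2 * m * b)) cy).
rewrite (_ : (fun s => _) = (fun s =>
  (cst (m ^+ 2) s - 2 * m * b * y s) - (- b ^+ 2) * y s ^+ 2)).
  rewrite -(primitive_linear (- b ^+ 2) c2 cy2 (lexx T)).
  rewrite -(primitive_linear (2 * m * b) c1 cy (lexx T)).
  by rewrite primitive_cst ?ltW// mulNr opprK.
by apply/funext => s /=; ring.
Qed.

Lemma nondegenerate_path : (exists2 t, 0 <= t <= T & y t != y 0) -> I1 ^+ 2 < T * I2.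
Proof.
move=> [t1 t1T yt1].
(* [m] is the mean of the path, and [T] times the integral of [g] is the determinant
   [T * I2 - I1 ^+ 2]. *)
pose m := I1 / T; pose g s := (m - y s) ^+ 2.
have cg : {within `[0, T], continuous g} by exact: within_continuous_sqrB.
have gE : primitive g T = (T * I2 - I1 ^+ 2) / T.
  rewrite (_ : g = fun s => (m - 1 * y s) ^+ 2); last first.
    by apply/funext => s; rewrite mul1r.
  rewrite primitive_sqr_affine /m; field; exact: lt0r_neq0.
suff : 0 < primitive g T.
  by rewrite gE pmulr_lgt0 ?invr_gt0// subr_gt0.
(* The path differs from its mean at 0 or at [t1], since its values there differ. *)
have [t0 t0T gt0] : exists2 t, 0 <= t <= T & 0 < g t.
  have [y0m|y0m] := eqVneq (y 0) m.
    exists t1 => //; rewrite /g exprn_even_gt0//= subr_eq0 eq_sym -y0m.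
    exact: yt1.
  by exists 0; rewrite ?lexx ?ltW// /g exprn_even_gt0//= subr_eq0 eq_sym.
have g20 : 0 < g t0 / 2 by rewrite divr_gt0.
have [r r0 Hr] := segment_unif_continuous cg g20.
have /andP[t00 t0T'] := t0T.
(* The neighbourhood of [t0] is clipped to [[0, T]]; it keeps positive length even if [t0] is an
   endpoint, because [0 < T]. *)
pose s := Num.max 0 (t0 - r / 2); pose t := Num.min T (t0 + r / 2).
have r20 : 0 < r / 2 by rewrite divr_gt0.
have s0 : 0 <= s by rewrite le_max lexx.
have tT : t <= T by rewrite ge_min lexx.
have st : s < t.
  by rewrite gt_max !lt_min T_gt0 ltr_wpDl//=; apply/andP; split; lra.
have gst u : s <= u <= t -> g t0 / 2 <= g u.
  rewrite ge_max le_min => /andP[/andP[u0 su] /andP[uT ut]].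
  have : `|g t0 - g u| < g t0 / 2.
    apply: Hr => //; first by rewrite u0.
    by rewrite ltr_norml; apply/andP; split; lra.
  by rewrite ltr_norml => /andP[_]; lra.
have ge0 (u v : R) : 0 <= u -> u <= v -> v <= T -> 0 <= primitive g v - primitive g u.
  move=> u0 uv vT; rewrite -[leLHS](mul0r (v - u)).
  by apply: (primitive_increment_ge cg) => // x _; exact: sqr_ge0.
have H1 := ge0 0 s (lexx 0) s0 (le_trans (ltW st) tT).
have H2 := ge0 t T (le_trans s0 (ltW st)) tT (lexx T).
have H3 := primitive_increment_ge cg s0 (ltW st) tT gst.
have H4 : 0 < g t0 / 2 * (t - s) by rewrite mulr_gt0// subr_gt0.
by move: H1; rewrite primitive0; lra.
Qed.

Lemma argmax_quadratic_exponential (A B : R) : I1 ^+ 2 < T * I2 ->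
  argmax (fun p : R * R => expR ((p.1 * A - p.2 * B) -
     2^-1 * primitive (fun s => (p.1 - p.2 * y s) ^+ 2) T)) =
  [set ((B * I1 - A * I2) / (I1 ^+ 2 - T * I2),
        (T * B - A * I1) / (I1 ^+ 2 - T * I2))].
Proof.
move=> I12; set mh := _ / _; set ah := (T * B - _) / _.
have D0 : I1 ^+ 2 - T * I2 != 0 by rewrite lt_eqF// subr_lt0.
pose Q (p : R * R) := (p.1 * A - p.2 * B) -
  2^-1 * (p.1 ^+ 2 * T - 2 * p.1 * p.2 * I1 + p.2 ^+ 2 * I2).
(* completing the square at the critical point *)
have QE p : Q (mh, ah) - Q p = (2 * T)^-1 *
    ((T * (p.1 - mh) - I1 * (p.2 - ah)) ^+ 2 +
     (T * I2 - I1 ^+ 2) * (p.2 - ah) ^+ 2).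
  by rewrite /Q /mh /ah /=; field; rewrite D0 gt_eqF.
have T20 : 0 < (2 * T)^-1 by rewrite invr_gt0 mulr_gt0.
have D1 : 0 < T * I2 - I1 ^+ 2 by rewrite subr_gt0.
have Q_le p : Q p <= Q (mh, ah).
  rewrite -subr_ge0 QE mulr_ge0 ?(ltW T20)// addr_ge0 ?sqr_ge0//.
  by rewrite mulr_ge0 ?sqr_ge0// ltW.
rewrite (_ : (fun p => _) = (fun p => expR (Q p))); last first.
  by apply/funext => p; rewrite primitive_sqr_affine.
apply/seteqP; split => [p /= Hp|_ -> q /=]; last by rewrite ler_expR.
(* At another maximizer the gap is also at most 0, so both squares vanish: the one weighted by the
   determinant fixes [p.2], then the other fixes [p.1]. *)
have := Hp (mh, ah); rewrite ler_expR -subr_le0 QE pmulr_rle0// => le0.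
have S1 := sqr_ge0 (T * (p.1 - mh) - I1 * (p.2 - ah)).
have S2 : 0 <= (T * I2 - I1 ^+ 2) * (p.2 - ah) ^+ 2.
  by rewrite mulr_ge0 ?sqr_ge0// ltW.
have /eqP : (T * I2 - I1 ^+ 2) * (p.2 - ah) ^+ 2 = 0 by lra.
rewrite mulf_eq0 gt_eqF//= expf_eq0/= subr_eq0 => /eqP p2.
have /eqP : (T * (p.1 - mh) - I1 * (p.2 - ah)) ^+ 2 = 0 by lra.
rewrite expf_eq0/= p2 subrr mulr0 subr0 mulf_eq0 gt_eqF//= subr_eq0 => /eqP p1.
by rewrite [p]surjective_pairing p1 p2.
Qed.

End maximizer.

(** * Almost surely the path is not constant *)

Section nondegeneracy.
Context (R : realType) (d : measure_display) (Omega : measurableType d)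
  (P : probability Omega R) (T mu a y0 : R) (F : R -> set (set Omega))
  (W Y : R -> Omega -> R).
Hypothesis T_gt0 : 0 < T.
Hypothesis F_filtration : filtration F T.
Hypothesis W_wiener : wiener_process P F T W.
Hypothesis Y_solution : ou_solution P F T W mu a y0 Y.

(* If [Y] were constant, [W T - W 0] would be the deterministic [-(mu - a y0) T]. *)
Lemma ou_path_not_constant :
  {ae P, forall w, exists2 t, 0 <= t <= T & Y t w != Y 0 w}.
Proof.
have T0T : 0 <= T <= T by rewrite ltW/=.
have O0T : 0 <= (0 : R) <= T by rewrite lexx ltW.
pose c := - ((mu - a * y0) * T).
have [_ _ Y0 YE] := Y_solution.
have incr_c : {ae P, forall w, (W T \- W 0) w != c}.
  exists ((W T \- W 0) @^-1` [set c]); split.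
  - rewrite -[X in measurable X]setTI.
    by apply: (wiener_increment_measurable F_filtration W_wiener) => //; exact: ltW.
  - have [_ _ _ WN _] := W_wiener.
    (* The law of the increment has a density, hence no atom at [c]. *)
    rewrite (WN 0 T (lexx 0) T_gt0 (lexx T) [set c] (measurable_set1 c)).
    by rewrite /normal_prob integral_set1.
  - by move=> w /= /negP; rewrite negbK => /eqP.
move: YE incr_c; apply: filterS2 => w YE incr_c.
apply: contrapT => const.
have YC t : 0 <= t <= T -> Y t w = y0.
  move=> t0T; apply/eqP; rewrite -(Y0 w).
  by apply: contrapT => /negP Yt; apply: const; exists t.
(* The integral equation at [t = 0] yields this on the path at hand, so no further null set is
   discarded. *)
have W0 : W 0 w = 0.
  have := YE 0 O0T; rewrite Y0 set_itv1 Rintegral_set1; lra.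
move: incr_c; rewrite /= W0 subr0.
have := YE T T0T; rewrite (YC T T0T).
rewrite (_ : (\int[_]_(s in _) _)%R = primitive (cst (mu - a * y0)) T); last first.
  by apply: eq_Rintegral => s; rewrite inE/= in_itv/= => s0T; rewrite /ou_drift YC.
rewrite primitive_cst ?ltW// /c => YT /eqP; apply; lra.
Qed.

End nondegeneracy.

Theorem mainTheorem2 (R : realType) (d : measure_display)
    (Omega : measurableType d) (P : probability Omega R)
    (T mu a y0 : R) (F : R -> set (set Omega)) (W Y : R -> Omega -> R)
    (T_gt0 : 0 < T)
    (F_filtration : filtration F T)
    (W_wiener : wiener_process P F T W)
    (Y_solution : ou_solution P F T W mu a y0 Y) :
  {ae P, forall w : Omega,
     argmax (likelihood T Y
               (ito_process_integral P F T W (ou_drift mu a Y) Y) w) =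
     [set (mu_hat T (fun t => Y t w), a_hat T (fun t => Y t w))]}.
Proof.
have stoch := ou_stochastic_integral T_gt0 F_filtration W_wiener Y_solution.
have nonconst := ou_path_not_constant T_gt0 F_filtration W_wiener Y_solution.
(* Neither exceptional set depends on the candidate pair [(m, b)], so the maximization over all
   pairs takes place on one fixed path. *)
move: stoch nonconst; apply: filterS2 => w stoch nonconst.
have cY : {within `[0, T], continuous (fun t => Y t w)}.
  by have [_ cY _ _] := Y_solution; exact: cY.
rewrite /likelihood stoch.
rewrite (argmax_quadratic_exponential T_gt0 cY _ _ (nondegenerate_path T_gt0 cY nonconst)).
rewrite /mu_hat /a_hat -/(primitive _ T); congr [set (_, _ / _)].
by rewrite mulrA (mulrC T).
Qed.
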